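(* Let $\alpha>0$. There is a randomized adaptive algorithm in the two-sided matvec query model such that, for any family $\mathcal{F}\subset\mathbb{R}^{n\times n}$ and any given $\alpha$-cover $\mathcal{F}'\subseteq\mathcal{F}$ of $\mathcal{F}$ of cardinality $\Gamma_\alpha$, any unknown $\mathbf{A}\in\mathbb{R}^{n\times n}$ and any $\epsilon,\delta\in(0,1)$, it uses $$O\!\left(\frac{\sqrt{\log\Gamma_\alpha}\cdot\log(\log\Gamma_\alpha/(\delta\epsilon))\cdot\log(\log\Gamma_\alpha/\epsilon)}{\epsilon^2}\right)$$ matvec queries with $\mathbf{A}$ and $\mathbf{A}^\mathsf{T}$ and returns $\tilde{\mathbf{B}}\in\mathcal{F}$ satisfying, with probability at least $1-\delta$, $$\|\mathbf{A}-\tilde{\mathbf{B}}\|_\mathsf{F}\le(3+\epsilon)\inf_{\mathbf{B}\in\mathcal{F}}\|\mathbf{A}-\mathbf{B}\|_\mathsf{F}+(3+\epsilon)\alpha.$$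
   Context: Two-sided matvec query model: the algorithm knows $\mathcal{F}$ and the cover $\mathcal{F}'$, and accesses the unknown $\mathbf{A}$ only through adaptively (possibly randomly) chosen queries $\mathbf{x}\mapsto\mathbf{A}\mathbf{x}$ or $\mathbf{x}\mapsto\mathbf{A}^\mathsf{T}\mathbf{x}$. An $\alpha$-cover of $\mathcal{F}$ is a subset $\mathcal{F}'\subseteq\mathcal{F}$ such that for every $\mathbf{X}\in\mathcal{F}$ there is $\mathbf{Y}\in\mathcal{F}'$ with $\|\mathbf{X}-\mathbf{Y}\|_\mathsf{F}\le\alpha$.
   Formalization: In the query bound the two inner logarithms, log(logΓ/(δε)) and log(logΓ/ε), are natural logs read as at least 1 (as printed the bound can be negative, e.g. Γ=2, ε=0.8); the family F is taken nonempty. *)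

(* Defs.v *)
From HB Require Import structures.
From mathcomp Require Import all_boot all_order all_algebra.
From mathcomp Require Import all_classical all_reals all_analysis.
Set Implicit Arguments. Unset Strict Implicit. Unset Printing Implicit Defensive.
Import Order.TTheory GRing.Theory Num.Theory.
Local Open Scope ring_scope.
Local Open Scope classical_set_scope.

Section Defs.
Variable R : realType.

Definition frob (n : nat) (A : 'M[R]_n) : R :=
  Num.sqrt (\sum_(i < n) \sum_(j < n) A i j ^+ 2).

Definition is_cover (n : nat) (F : set 'M[R]_n) (F' : seq 'M[R]_n) (alpha : R) :=
  [/\ uniq F', (forall Y, Y \in F' -> F Y) &
      forall X, F X -> exists2 Y, Y \in F' & frob (X - Y) <= alpha].

(* Two-sided matvec query model.  A query is a pair (b, x): b = false asks
   for A x, b = true asks for A^T x.  A randomized adaptive algorithm with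
   random seed in Omega chooses each query as a function of the seed and of
   all previous answers, and its output as a function of the seed and of all
   answers. *)
Record matvec_alg (Omega : Type) (n : nat) := MatvecAlg {
  mv_query  : Omega -> seq 'cV[R]_n -> bool * 'cV[R]_n ;
  mv_output : Omega -> seq 'cV[R]_n -> 'M[R]_n }.

Definition mv_answer (n : nat) (A : 'M[R]_n) (qr : bool * 'cV[R]_n) : 'cV[R]_n :=
  if qr.1 then A^T *m qr.2 else A *m qr.2.

Fixpoint mv_transcript (Omega : Type) (n : nat) (alg : matvec_alg Omega n)
    (w : Omega) (A : 'M[R]_n) (k : nat) : seq 'cV[R]_n :=
  match k with
  | 0 => [::]
  | k'.+1 => let h := mv_transcript alg w A k' in
             rcons h (mv_answer A (mv_query alg w h))
  end.

Definition mv_run (Omega : Type) (n : nat) (alg : matvec_alg Omega n)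
    (w : Omega) (A : 'M[R]_n) (q : nat) : 'M[R]_n :=
  mv_output alg w (mv_transcript alg w A q).

(* log clipped below at 1, the usual convention inside O(.) bounds *)
Definition lg1 (x : R) : R := Num.max 1 (ln x).

End Defs.

(* Main.v *)
(** [E := A - B1], where [B1] in the cover minimises [fsq ((A - B) *m G)] for a
    sign matrix [G] with [m] columns, and [r ~ sqrt (ln Gamma)].  A Laplace
    transform bound, uniform over the cover, shows that [E] has fewer than [r]
    squared singular values above [4 w^2 / r] and that the rest has energy at
    most [(1 + O(eps)) w^2], where [w = inf + alpha]: clipping the spectrum at
    that level makes the failure probability [exp (- Omega (m eps^2 r))], which
    beats the [Gamma] events as soon as [m eps^2 >= O(sqrt (ln Gamma))].
    Multiplying [E] by [O(r (ln r + 1 / eps))] further sign vectors gives [Y]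
    whose column space contains an almost optimal rank [r] approximation of
    [E]: the residual of the sketched regression onto the heavy singular
    vectors is a matrix orthogonal to the tail, and it is small in second
    moment.  Independent blocks amplify the success probability.  Queries to
    the transpose at the columns of [Y] then determine [Ah = B1 + Y *m K] with
    [frob (A - Ah) <= (1 + O(eps)) w], and the element of the cover nearest to
    [Ah] is within [(3 + eps) w] of [A]. *)
Require Import Defs.
From HB Require Import structures.
From mathcomp Require Import all_boot all_order all_algebra.
From mathcomp Require Import all_classical all_reals all_analysis.
From mathcomp Require Import ring lra complex.
Set Implicit Arguments. Unset Strict Implicit. Unset Printing Implicit Defensive.
Import Order.TTheory GRing.Theory Num.Theory numFieldNormedType.Exports.
Local Open Scope ring_scope.

(** * Expectation and probability over a uniform finite sample space *)

Section FiniteExpectation.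
Variable R : realType.

(** Division by zero makes this 0 when [U] is empty, which is why some lemmas below assume
    [0 < #|U|]. *)
Definition expect (U : finType) (f : U -> R) : R := (\sum_u f u) / #|U|%:R.

Lemma eq_expect (U : finType) (f g : U -> R) : f =1 g -> expect f = expect g.
Proof. by move=> fg; congr (_ / _); apply: eq_bigr => u _. Qed.

Lemma ler_expect (U : finType) (f g : U -> R) :
  (forall u, f u <= g u) -> expect f <= expect g.
Proof. by move=> fg; apply: ler_wpM2r; rewrite ?invr_ge0 ?ler0n// ler_sum. Qed.

Lemma expectD (U : finType) (f g : U -> R) :
  expect (fun u => f u + g u) = expect f + expect g.
Proof. by rewrite /expect big_split mulrDl. Qed.

Lemma expectZ (U : finType) (c : R) (f : U -> R) :
  expect (fun u => c * f u) = c * expect f.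
Proof. by rewrite /expect -mulr_sumr mulrA. Qed.

Lemma expectZr (U : finType) (c : R) (f : U -> R) :
  expect (fun u => f u * c) = expect f * c.
Proof. by rewrite mulrC -expectZ; apply: eq_expect => u; rewrite mulrC. Qed.

Lemma expect_sum (U I : finType) (F : I -> U -> R) :
  expect (fun u => \sum_i F i u) = \sum_i expect (F i).
Proof. by rewrite /expect exchange_big /= mulr_suml. Qed.

Lemma expect_cst (U : finType) (c : R) : (0 < #|U|)%N -> expect (fun _ : U => c) = c.
Proof.
by move=> U0; rewrite /expect sumr_const -[X in X / _]mulr_natr mulfK// pnatr_eq0 -lt0n.
Qed.

Lemma expect_ge0 (U : finType) (f : U -> R) : (forall u, 0 <= f u) -> 0 <= expect f.
Proof. by move=> f0; rewrite divr_ge0 ?ler0n ?sumr_ge0. Qed.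

Lemma expect_bool (f : bool -> R) : expect f = (f true + f false) / 2.
Proof. by rewrite /expect card_bool big_bool. Qed.

Lemma expect_pair (U V : finType) (f : U * V -> R) :
  expect f = expect (fun u => expect (fun v => f (u, v))).
Proof.
rewrite /expect card_prod natrM invfM -mulr_suml -mulrA [_^-1 / _]mulrC.
by congr (_ * _); rewrite pair_bigA; apply: eq_bigr => -[].
Qed.

Definition fcons (U : finType) n (u : U) (z : {ffun 'I_n -> U}) : {ffun 'I_n.+1 -> U} :=
  [ffun i => if unlift ord0 i is Some j then z j else u].

Lemma fcons0 (U : finType) n (u : U) (z : {ffun 'I_n -> U}) : fcons u z ord0 = u.
Proof. by rewrite ffunE unlift_none. Qed.

Lemma fconsS (U : finType) n (u : U) (z : {ffun 'I_n -> U}) j :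
  fcons u z (lift ord0 j) = z j.
Proof. by rewrite ffunE liftK. Qed.

(** Fubini for the first coordinate, since [fcons] is a bijection. The inductions on the number of
    signs or of independent samples peel with it. *)
Lemma expect_fcons (U : finType) n (f : {ffun 'I_n.+1 -> U} -> R) :
  expect f = expect (fun u => expect (fun z : {ffun 'I_n -> U} => f (fcons u z))).
Proof.
rewrite -(expect_pair (fun x => f (fcons x.1 x.2))) /expect.
rewrite card_prod !card_ffun !card_ord expnS; congr (_ / _).
rewrite (reindex (fun x : U * {ffun 'I_n -> U} => fcons x.1 x.2)) //=.
exists (fun z => (z ord0, [ffun j => z (lift ord0 j)])) => [[u z] _|z _] /=.
  by rewrite fcons0; congr pair; apply/ffunP => j; rewrite ffunE fconsS.
by apply/ffunP => i; rewrite ffunE; case: unliftP => [j|] ->; rewrite ?ffunE.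
Qed.

Lemma expect_ffun0 (U : finType) (f : {ffun 'I_0 -> U} -> R) (z0 : {ffun 'I_0 -> U}) :
  expect f = f z0.
Proof.
rewrite (eq_expect (g := fun=> f z0)); last by move=> z; congr f; apply/ffunP => -[].
by rewrite expect_cst// card_ffun card_ord.
Qed.

Lemma expect_prod (U : finType) n (f : U -> R) :
  expect (fun z : {ffun 'I_n -> U} => \prod_i f (z i)) = expect f ^+ n.
Proof.
elim: n => [|n IH].
  rewrite (eq_expect (g := fun=> 1)); last by move=> z; rewrite big_ord0.
  by rewrite expect_cst// card_ffun card_ord expn0.
rewrite expect_fcons exprS -IH -expectZr; apply: eq_expect => u.
rewrite -expectZ; apply: eq_expect => z; rewrite big_ord_recl fcons0.
by congr (_ * _); apply: eq_bigr => i _; rewrite fconsS.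
Qed.

Definition prob (U : finType) (P : pred U) : R := expect (fun u => (P u)%:R).

Lemma ler_prob (U : finType) (P Q : pred U) :
  (forall u, P u -> Q u) -> prob P <= prob Q.
Proof.
move=> PQ; apply: ler_expect => u; rewrite ler_nat; case: (P u) (PQ u) => //.
by move=> ->.
Qed.

Lemma prob_ge0 (U : finType) (P : pred U) : 0 <= prob P.
Proof. by apply: expect_ge0 => u; rewrite ler0n. Qed.

Lemma prob_le1 (U : finType) (P : pred U) : prob P <= 1.
Proof.
rewrite /prob /expect -natr_sum; have [->|U0] := posnP #|U|.
  by rewrite invr0 mulr0.
rewrite ler_pdivrMr ?ltr0n// mul1r ler_nat -sum1_card leq_sum// => u _.
exact: leq_b1.
Qed.

Lemma prob_or (U : finType) (P Q : pred U) :
  prob (fun u => P u || Q u) <= prob P + prob Q.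
Proof.
rewrite /prob -expectD; apply: ler_expect => u.
by rewrite -natrD ler_nat; case: (P u); case: (Q u).
Qed.

Lemma prob_exists (U I : finType) (P : I -> pred U) :
  prob (fun u => [exists i, P i u]) <= \sum_i prob (P i).
Proof.
rewrite /prob -expect_sum; apply: ler_expect => u.
case: existsP => [[i Pi]|_]; last by rewrite sumr_ge0// => i _; rewrite ler0n.
by rewrite (bigD1 i)//= Pi lerDl sumr_ge0// => j _; rewrite ler0n.
Qed.

Lemma prob_has (U : finType) (I : eqType) (s : seq I) (P : I -> pred U) :
  prob (fun u => has (P ^~ u) s) <= \sum_(i <- s) prob (P i).
Proof.
elim: s => [|i s IH].
  by rewrite big_nil /prob /expect big1 ?mul0r.
by rewrite big_cons (le_trans (prob_or _ _))// lerD2l.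
Qed.

Lemma prob_compl (U : finType) (P : pred U) : (0 < #|U|)%N ->
  prob (fun u => ~~ P u) = 1 - prob P.
Proof.
move=> U0; apply/eqP; rewrite -subr_eq0 opprB addrA subr_eq0 addrC /prob -expectD.
rewrite (eq_expect (g := fun=> 1)) ?expect_cst// => u.
by case: (P u); rewrite ?addr0 ?add0r.
Qed.

Lemma markov_prob (U : finType) (f : U -> R) (P : pred U) (a b : R) :
  0 < a -> (forall u, 0 <= f u) -> (forall u, P u -> a <= f u) -> expect f <= a * b ->
  prob P <= b.
Proof.
move=> a0 f0 Pf Ef; rewrite -(ler_pM2l a0) (le_trans _ Ef)// /prob -expectZ.
apply: ler_expect => u; case: (boolP (P u)) => [/Pf|_]; rewrite ?mulr1 ?mulr0//.
Qed.

Lemma prob_forall (U : finType) n (P : pred U) :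
  prob (fun z : {ffun 'I_n -> U} => [forall i, P (z i)]) = prob P ^+ n.
Proof.
rewrite /prob -expect_prod; apply: eq_expect => z.
case: forallP => [Pz|nP]; first by rewrite big1 // => i _; rewrite Pz.
have /existsP[i /negbTE Pi] : [exists i, ~~ P (z i)].
  by rewrite -negb_forall; apply/forallP.
by rewrite (bigD1 i)//= Pi mul0r.
Qed.

(** A conditional union bound: the second event has to be rare only for good outcomes of the first
    sample. It handles the second sketch, whose target matrix depends on the first one. *)
Lemma prob_pair (U V : finType) (P : pred U) (Q : U -> pred V) (b : R) : 0 <= b ->
  (forall u, ~~ P u -> prob (Q u) <= b) -> (0 < #|U|)%N ->
  prob (fun x : U * V => P x.1 || Q x.1 x.2) <= prob P + b.
Proof.
move=> b0 Qb U0; rewrite {1}/prob expect_pair.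
rewrite -[X in _ <= _ + X](@expect_cst U)// /prob -expectD.
apply: ler_expect => u /=; have [Pu|nPu] := boolP (P u).
  by apply: (le_trans (prob_le1 (fun=> true))); rewrite lerDl.
by rewrite add0r; exact: Qb.
Qed.

(** Independence and zero mean kill the cross terms, so the second moment grows like [n] and not
    like [n ^+ 2]. *)
Lemma expect_sum_sqr (U : finType) n (f : U -> R) : expect f = 0 ->
  expect (fun z : {ffun 'I_n -> U} => (\sum_i f (z i)) ^+ 2)
  = n%:R * expect (fun u => f u ^+ 2).
Proof.
move=> f0; elim: n => [|n IH].
  have z0 : {ffun 'I_0 -> U} by apply: finfun; case.
  by rewrite (expect_ffun0 _ z0) big_ord0 expr0n mul0r.
have [U0|U0] := posnP #|U|.
  rewrite /expect big1 ?mul0r; last first.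
    by move=> z _; have := card0_eq U0 (z ord0); rewrite inE.
  by rewrite U0 invr0 !mulr0.
have cz : (0 < #|{ffun 'I_n -> U}|)%N by rewrite card_ffun expn_gt0 U0.
have S0 : expect (fun z : {ffun 'I_n -> U} => \sum_i f (z i)) = 0.
  elim: n {IH} cz => [|n IH] cz.
    have z0 : {ffun 'I_0 -> U} by apply: finfun; case.
    by rewrite (expect_ffun0 _ z0) big_ord0.
  have cz' : (0 < #|{ffun 'I_n -> U}|)%N by rewrite card_ffun expn_gt0 U0.
  rewrite expect_fcons (eq_expect (g := f)) // => u.
  rewrite (eq_expect (g := fun z : {ffun 'I_n -> U} => f u + \sum_i f (z i))) => [|z].
    by rewrite expectD IH// expect_cst// addr0.
  by rewrite big_ord_recl fcons0; congr (_ + _); apply: eq_bigr => i _; rewrite fconsS.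
rewrite expect_fcons (eq_expect (g := fun u => f u ^+ 2 + n%:R * expect (fun u => f u ^+ 2))).
  by rewrite expectD expect_cst// -[n.+1]addn1 natrD mulrDl mul1r addrC.
move=> u; rewrite -IH.
rewrite (eq_expect (g := fun z : {ffun 'I_n -> U} => f u ^+ 2 + (2 * f u * (\sum_i f (z i)) + (\sum_i f (z i)) ^+ 2))) => [|z].
  by rewrite expectD expect_cst// expectD expectZ S0 mulr0 add0r.
rewrite big_ord_recl fcons0 (eq_bigr (fun i => f (z i))); first by ring.
by move=> i _; rewrite fconsS.
Qed.

End FiniteExpectation.

(** * Laplace transforms of quadratic forms in random signs *)

Section RademacherLaplace.
Variable R : realType.

Lemma ger0_derive_homo (f f' : R -> R) :
  (forall x : R, is_derive x (1 : R) f (f' x)) -> (forall x, 0 <= x -> 0 <= f' x) ->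
  forall x, 0 <= x -> f 0 <= f x.
Proof.
move=> df f'0 x x0.
apply: (@ger0_derive1_le_cc R f 0 x); rewrite ?in_itv/= ?lexx ?x0//.
- move=> y; rewrite in_itv/= => /andP[y0 _].
  by rewrite derive1E (@derive_val _ _ _ _ _ _ _ (df y)) f'0// ltW.
- apply: derivable_within_continuous => y _.
  by have := df y => -[].
Qed.

(** On the nonnegative axis [expR (- (y ^+ 2 / 2)) * (expR y + expR (- y))] decreases from 2: its
    derivative is [- expR (- (y ^+ 2 / 2)) * s y], and [s] is nonnegative because [s 0 = 0] and its
    derivative is [y * (expR y - expR (- y))]. *)
Lemma cosh_le_expR (x : R) : (expR x + expR (- x)) / 2 <= expR (x ^+ 2 / 2).
Proof.
wlog x0 : x / 0 <= x.
  move=> H; have [/H//|x0] := leP 0 x.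
  by have := H (- x); rewrite opprK sqrrN addrC; apply; lra.
pose s (y : R) := y * (expR y + expR (- y)) - (expR y - expR (- y)).
have s0 y : 0 <= y -> 0 <= s y.
  move=> y0; have -> : 0 = s 0 by rewrite /s oppr0 expR0; ring.
  apply: (@ger0_derive_homo s (fun y => y * (expR y - expR (- y)))) => // z.
    rewrite /s; apply: is_derive_eq => /=.
    by rewrite /GRing.scale/=; ring.
  by move=> z0; rewrite mulr_ge0// subr_ge0 ler_expR; lra.
pose h (y : R) := - (expR (- (y ^+ 2 / 2)) * (expR y + expR (- y))).
have : h 0 <= h x.
  apply: (@ger0_derive_homo h (fun y => expR (- (y ^+ 2 / 2)) * s y)) => // z.
    rewrite /h /s; apply: is_derive_eq => /=.
    by rewrite /GRing.scale/=; field.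
  by move=> z0; rewrite mulr_ge0// ?expR_ge0 ?s0.
rewrite /h expr0n mul0r oppr0 expR0 mul1r lerN2 expRN mulrC -ler_pdivlMr ?invr_gt0 ?expR_gt0//.
by rewrite invrK ler_pdivrMr// mulrC.
Qed.

(* Functions on ordinals instead of column vectors keep the peeling of the
   first coordinate free of block matrices. *)
Definition qform n (A : 'I_n -> 'I_n -> R) (x : 'I_n -> R) : R :=
  \sum_i \sum_j A i j * (x i * x j).

Definition vcons n (c : R) (x : 'I_n -> R) (i : 'I_n.+1) : R :=
  if unlift ord0 i is Some j then x j else c.

Lemma vcons0 n c (x : 'I_n -> R) : vcons c x ord0 = c.
Proof. by rewrite /vcons unlift_none. Qed.

Lemma vconsS n c (x : 'I_n -> R) j : vcons c x (lift ord0 j) = x j.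
Proof. by rewrite /vcons liftK. Qed.

Definition symf n (A : 'I_n -> 'I_n -> R) := forall i j, A i j = A j i.
Definition psdf n (A : 'I_n -> 'I_n -> R) := forall x, 0 <= qform A x.

Lemma eq_qform n (A : 'I_n -> 'I_n -> R) x y : x =1 y -> qform A x = qform A y.
Proof.
by move=> xy; apply: eq_bigr => i _; apply: eq_bigr => j _; rewrite !xy.
Qed.

Lemma qformZ n (A : 'I_n -> 'I_n -> R) c x :
  qform (fun i j => c * A i j) x = c * qform A x.
Proof.
rewrite /qform mulr_sumr; apply: eq_bigr => i _.
by rewrite mulr_sumr; apply: eq_bigr => j _; rewrite -mulrA.
Qed.

Lemma qform_recl n (A : 'I_n.+1 -> 'I_n.+1 -> R) (x : 'I_n.+1 -> R) : symf A ->
  let v j := A ord0 (lift ord0 j) in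
  let x' j := x (lift ord0 j) in
  qform A x = A ord0 ord0 * x ord0 ^+ 2 + 2 * x ord0 * (\sum_j v j * x' j)
              + qform (fun i j => A (lift ord0 i) (lift ord0 j)) x'.
Proof.
move=> sA /=; rewrite /qform big_ord_recl big_ord_recl /=.
under [X in _ + X = _]eq_bigr do rewrite big_ord_recl.
rewrite big_split /= addrA; congr (_ + _); rewrite -addrA expr2; congr (_ + _).
rewrite -mulrA mulr_natl mulr2n; congr (_ + _).
  by rewrite mulr_sumr; apply: eq_bigr => j _; ring.
by rewrite mulr_sumr; apply: eq_bigr => j _; rewrite sA; ring.
Qed.

Lemma qform_rank1 n (A : 'I_n -> 'I_n -> R) (c : R) (v x : 'I_n -> R) :
  qform (fun i j => A i j + c * (v i * v j)) x
  = qform A x + c * (\sum_j v j * x j) ^+ 2.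
Proof.
rewrite /qform expr2 mulr_suml mulr_sumr -big_split; apply: eq_bigr => i _ /=.
rewrite !mulr_sumr -big_split; apply: eq_bigr => j _ /=; ring.
Qed.

Definition sgv n (z : {ffun 'I_n -> bool}) (i : 'I_n) : R := (-1) ^+ z i.

Lemma sgv_fcons n b (z : {ffun 'I_n -> bool}) :
  sgv (fcons b z) =1 vcons ((-1) ^+ b) (sgv z).
Proof. by move=> i; rewrite /sgv /vcons ffunE; case: unliftP. Qed.

Lemma symfS n (A : 'I_n.+1 -> 'I_n.+1 -> R) c : symf A ->
  symf (fun i j => A (lift ord0 i) (lift ord0 j)
                   + c * (A ord0 (lift ord0 i) * A ord0 (lift ord0 j))).
Proof. by move=> sA i j; rewrite sA; ring. Qed.

Lemma qform_vcons n (A : 'I_n.+1 -> 'I_n.+1 -> R) c (x : 'I_n -> R) : symf A ->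
  qform A (vcons c x) =
  A ord0 ord0 * c ^+ 2 + 2 * c * (\sum_j A ord0 (lift ord0 j) * x j)
  + qform (fun i j => A (lift ord0 i) (lift ord0 j)) x.
Proof.
move=> sA; rewrite qform_recl// vcons0; congr (_ + _ * _ + _).
  by apply: eq_bigr => j _; rewrite vconsS.
by apply: eq_qform => j; rewrite vconsS.
Qed.

Lemma sum_vcons_sqr n c (x : 'I_n -> R) :
  \sum_i vcons c x i ^+ 2 = c ^+ 2 + \sum_i x i ^+ 2.
Proof. by rewrite big_ord_recl vcons0; under eq_bigr do rewrite vconsS. Qed.

(* Averaging the first sign turns the cross term into a cosh. *)
Lemma expect_expR_qform_recl n (A : 'I_n.+1 -> 'I_n.+1 -> R) (s : R) : symf A ->
  s ^+ 2 = 1 ->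
  expect (fun z : {ffun 'I_n.+1 -> bool} => expR (s * qform A (sgv z) / 2))
  <= expR (s * A ord0 ord0 / 2) * expect (fun z : {ffun 'I_n -> bool} =>
     expR (s * qform (fun i j => A (lift ord0 i) (lift ord0 j)
       + s * (A ord0 (lift ord0 i) * A ord0 (lift ord0 j))) (sgv z) / 2)).
Proof.
move=> sA s1; rewrite expect_fcons expect_bool -expectD -expectZr -expectZ.
apply: ler_expect => z.
rewrite !(eq_qform _ (sgv_fcons _ _)) !qform_vcons// expr0 expr1 sqrrN expr1n qform_rank1.
set q := qform _ _; set v := \sum_j _; set a := A _ _.
have -> : s * (a * 1 + 2 * (-1) * v + q) / 2 = s * a / 2 + s * q / 2 + - (s * v) by field.
have -> : s * (a * 1 + 2 * 1 * v + q) / 2 = s * a / 2 + s * q / 2 + s * v by field.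
have -> : s * (q + s * v ^+ 2) / 2 = s * q / 2 + (s * v) ^+ 2 / 2 by field.
rewrite !expRD -mulrDr -!mulrA ler_pM2l ?expR_gt0// ler_pM2l ?expR_gt0// addrC.
have -> : s * (v * (s * (v / 2))) = (s * v) ^+ 2 / 2 by field.
exact: cosh_le_expR.
Qed.

Lemma psdf_diag n (A : 'I_n -> 'I_n -> R) i : psdf A -> 0 <= A i i.
Proof.
move=> /(_ (fun j => (j == i)%:R)); rewrite /qform (bigD1 i)//=.
rewrite [X in _ + X]big1 ?addr0 => [|j /negbTE ->]; last first.
  by rewrite big1// => k _; rewrite mul0r mulr0.
rewrite (bigD1 i)//= [X in _ + X]big1 ?addr0 => [|j /negbTE ->].
  by rewrite eqxx !mulr1.
by rewrite !mulr0.
Qed.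

(** Induction on the dimension. Averaging the first sign replaces [A] by its lower right block minus
    [v v^T], where [v] is the rest of the first row. The new form still lies between 0 and [c] times
    the identity, and its trace drops by [V <= c * a] only, a loss that the factor [1 - c] leaves
    room for. *)
Lemma rademacher_laplace_lower n (A : 'I_n -> 'I_n -> R) (c : R) : 0 < c <= 1 ->
  symf A -> psdf A -> (forall x, qform A x <= c * \sum_i x i ^+ 2) ->
  expect (fun z : {ffun 'I_n -> bool} => expR (- 1 * qform A (sgv z) / 2))
  <= expR (- ((1 - c) * (\sum_i A i i) / 2)).
Proof.
move=> /andP[c0 c1]; elim: n A => [|n IH] A sA pA cA.
  have z0 : {ffun 'I_0 -> bool} by apply: finfun; case.
  by rewrite (expect_ffun0 _ z0) /qform !big_ord0 !(mulr0, mul0r, oppr0).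
apply: (le_trans (expect_expR_qform_recl _ _)) => //; first by rewrite sqrrN expr1n.
set a := A ord0 ord0; pose v j := A ord0 (lift ord0 j).
pose A' i j := A (lift ord0 i) (lift ord0 j).
pose A2 i j := A' i j + - 1 * (v i * v j).
(* Positivity of [A] at the vector with first coordinate [- w] gives
   [(2 - a) * w ^+ 2 <= qform A' x], and [a <= 1]. *)
have pv x : (\sum_j v j * x j) ^+ 2 <= qform A' x.
  have := pA (vcons (- \sum_j v j * x j) x); rewrite qform_vcons// -/a -/A'.
  set w := \sum_j _ => pw.
  have a1 : a <= 1.
    have := cA (vcons 1 (fun=> 0)); rewrite qform_vcons// -/a big1; last by move=> *; rewrite mulr0.
    rewrite /qform big1; last by move=> i _; rewrite big1// => j _; rewrite !mulr0.
    rewrite sum_vcons_sqr big1; last by move=> i _; rewrite expr0n.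
    lra.
  have : a * w ^+ 2 <= 1 * w ^+ 2 by rewrite ler_wpM2r// sqr_ge0.
  lra.
have IHA : expect (fun z : {ffun 'I_n -> bool} => expR (- 1 * qform A2 (sgv z) / 2))
    <= expR (- ((1 - c) * (\sum_i A2 i i) / 2)).
  apply: IH; first exact: symfS.
    by move=> x; rewrite qform_rank1; have := pv x; lra.
  move=> x; rewrite qform_rank1; have := cA (vcons 0 x).
  rewrite qform_vcons// sum_vcons_sqr -/A' -/a.
  by have := sqr_ge0 (\sum_j v j * x j); lra.
apply: (le_trans (ler_wpM2l (expR_ge0 _) IHA)).
rewrite -expRD ler_expR big_ord_recl -/a.
have -> : \sum_i A2 i i = \sum_i A' i i - \sum_i v i ^+ 2.
  by rewrite -sumrB; apply: eq_bigr => i _; rewrite /A2; ring.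
set V := \sum_i v i ^+ 2; set T := \sum_i A' i i.
(* The two test vectors combine to [a ^+ 2 + V <= c * a], the first diagonal entry of the inequality
   between [A ^ 2] and [c A]. *)
have Vca : V <= c * a.
  have := cA (vcons a v); have := pA (vcons (c - a) (fun j => - v j)).
  rewrite !qform_vcons// -/a -/A' sum_vcons_sqr -/V.
  have -> : \sum_j A ord0 (lift ord0 j) * - v j = - V.
    by rewrite -sumrN; apply: eq_bigr => i _; rewrite /v; ring.
  have -> : qform A' (fun j => - v j) = qform A' v.
    by apply: eq_bigr => i _; apply: eq_bigr => j _; ring.
  move=> h1 h2; rewrite -(ler_pM2l c0).
  have := sqr_ge0 a; nra.
have a0 : 0 <= a by apply: psdf_diag.
have V0 : 0 <= V by apply: sumr_ge0 => i _; exact: sqr_ge0.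
suff : (1 - c) * V <= c * a by lra.
by rewrite (le_trans _ Vca)// ler_piMl//; lra.
Qed.

(** The same induction with [v v^T] added. The minors of order two give [v j ^+ 2 <= a * A' j j], so
    the new trace is at most [(1 + a) * T]. Hence one minus the trace is nearly multiplicative
    ([T21]), which keeps the trace below 1 and closes the induction. *)
Lemma rademacher_laplace_upper n (A : 'I_n -> 'I_n -> R) : symf A -> psdf A ->
  let t := \sum_i A i i in t < 1 ->
  expect (fun z : {ffun 'I_n -> bool} => expR (1 * qform A (sgv z) / 2))
  <= expR (((1 - t)^-1 - 1) / 2).
Proof.
elim: n A => [|n IH] A sA pA t t1.
  have z0 : {ffun 'I_0 -> bool} by apply: finfun; case.
  rewrite (expect_ffun0 _ z0) /qform /t !big_ord0 !(mulr0, mul0r) subr0 invr1.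
  by rewrite subrr mul0r.
apply: (le_trans (expect_expR_qform_recl _ _)) => //; first by rewrite expr1n.
move: t1; rewrite /t big_ord_recl.
set a := A ord0 ord0; pose v j := A ord0 (lift ord0 j).
pose A' i j := A (lift ord0 i) (lift ord0 j).
pose A2 i j := A' i j + 1 * (v i * v j).
set T := \sum_i A _ _; move=> t1.
have T0 : 0 <= T by apply: sumr_ge0 => i _; apply: psdf_diag.
have a0 : 0 <= a by apply: psdf_diag.
have va j : v j ^+ 2 <= a * A' j j.
  have minor x y : 0 <= a * x ^+ 2 + 2 * x * (v j * y) + A' j j * y ^+ 2.
    have := pA (vcons x (fun i => (i == j)%:R * y)); rewrite qform_vcons// -/a.
    rewrite (bigD1 j)//= eqxx mul1r big1 ?addr0; last first.
      by move=> i /negbTE ->; rewrite mul0r mulr0.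
    rewrite /qform (bigD1 j)//= [X in _ + (_ + X)]big1 ?addr0; last first.
      by move=> i /negbTE ->; rewrite big1// => k _; rewrite !mul0r mulr0.
    rewrite (bigD1 j)//= [X in _ + (_ + X)]big1 ?addr0; last first.
      by move=> i /negbTE ->; rewrite !(mul0r, mulr0).
    by rewrite eqxx !mul1r -expr2.
  have d0 : 0 <= A' j j by exact: (psdf_diag (lift ord0 j) pA).
  have [ap|a00] := ltP 0 a.
    have := minor (- v j) a; have -> : a * (- v j) ^+ 2 + 2 * - v j * (v j * a) + A' j j * a ^+ 2
      = a * (a * A' j j - v j ^+ 2) by ring.
    by rewrite pmulr_rge0// subr_ge0.
  have az : a = 0 by lra.
  have := minor (- (1 + A' j j)) (v j); rewrite az.
  (* When [a = 0] this test vector yields [- (2 + A' j j) * v j ^+ 2 >= 0], hence [v j = 0]. *)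
  have := sqr_ge0 (v j); have := mulr_ge0 d0 (sqr_ge0 (v j)); nra.
have VT : \sum_i v i ^+ 2 <= a * T by rewrite /T mulr_sumr ler_sum.
have TE : \sum_i A2 i i = T + \sum_i v i ^+ 2.
  by rewrite -big_split; apply: eq_bigr => i _; rewrite /A2 mul1r -expr2.
have T21 : 1 - (a + T) <= (1 - a) * (1 - \sum_i A2 i i).
  rewrite TE.
  have a1 : 0 <= 1 - a by lra.
  have := ler_wpM2l a1 VT; have := mulr_ge0 (mulr_ge0 a0 a0) T0; nra.
have T2p : 0 < 1 - \sum_i A2 i i.
  have h : 0 < (1 - a) * (1 - \sum_i A2 i i) by lra.
  by rewrite -(pmulr_rgt0 _ (_ : 0 < 1 - a))//; lra.
have IHA : expect (fun z : {ffun 'I_n -> bool} => expR (1 * qform A2 (sgv z) / 2))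
    <= expR (((1 - \sum_i A2 i i)^-1 - 1) / 2).
  apply: IH; [exact: symfS| |by lra].
  move=> x; rewrite qform_rank1 mul1r addr_ge0 ?sqr_ge0//.
  by have := pA (vcons 0 x); rewrite qform_vcons//; lra.
apply: (le_trans (ler_wpM2l (expR_ge0 _) IHA)).
rewrite -expRD ler_expR.
set y := 1 - \sum_i A2 i i in T21 T2p *.
suff : a + y^-1 <= (1 - (a + T))^-1 by lra.
have y1 : y <= 1.
  by rewrite /y TE gerBl addr_ge0// sumr_ge0// => i _; exact: sqr_ge0.
have p0 : 0 < 1 - (a + T) by lra.
rewrite -[leRHS]mul1r ler_pdivlMr//.
apply: (@le_trans _ _ ((a + y^-1) * ((1 - a) * y))).
  by rewrite ler_wpM2l// addr_ge0// invr_ge0 ltW.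
have -> : (a + y^-1) * ((1 - a) * y) = (1 - a) * (a * y + 1) by field; lra.
have : a * y <= a by rewrite ler_piMr.
by have := mulr_ge0 a0 (ltW T2p); nra.
Qed.

End RademacherLaplace.

(** * Chernoff bounds for sums of quadratic forms, and moments of sign sums *)

Section RademacherTails.
Variable R : realType.

Lemma expect_expR_sum (U : finType) m (f : U -> R) :
  expect (fun z : {ffun 'I_m -> U} => expR (\sum_k f (z k)))
  = expect (fun u => expR (f u)) ^+ m.
Proof. by rewrite -expect_prod; apply: eq_expect => z; rewrite expR_sum. Qed.

Lemma card_sign n : (0 < #|{ffun 'I_n -> bool}|)%N.
Proof. by rewrite card_ffun card_bool expn_gt0. Qed.

Lemma psdfZ n (A : 'I_n -> 'I_n -> R) c : 0 <= c -> psdf A -> psdf (fun i j => c * A i j).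
Proof. by move=> c0 pA x; rewrite qformZ mulr_ge0. Qed.

(** The Chernoff exponent is proportional to the ratio of the trace of [N] to its norm bound [nu],
    an effective rank. This is the source of the factor [r] gained later by clipping. *)
Lemma prob_qform_lower n m (N : 'I_n -> 'I_n -> R) (nu t : R) :
  0 < nu -> 0 < t <= 1 -> symf N -> psdf N ->
  (forall x, qform N x <= nu * \sum_i x i ^+ 2) ->
  prob R (fun z : {ffun 'I_m -> {ffun 'I_n -> bool}} =>
          \sum_k qform N (sgv R (z k)) <= (1 - t) * (m%:R * \sum_i N i i))
  <= expR (- (m%:R * t ^+ 2 * (\sum_i N i i) / (8 * nu))).
Proof.
move=> nu0 /andP[t0 t1] sN pN leN; set tr := \sum_i N i i.
(* This [s] makes the scaled form bounded by [c = t / 2], half of the deviation [t]; the other half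
   of [t] is left for the exponent. *)
pose s := t / (2 * nu); have s0 : 0 < s by rewrite divr_gt0// mulr_gt0.
have snu : s * nu = t / 2 by rewrite /s; field; lra.
have L1 : expect (fun z : {ffun 'I_n -> bool} =>
    expR (- 1 * qform (fun i j => s * N i j) (sgv R z) / 2))
    <= expR (- ((1 - t / 2) * (s * tr) / 2)).
  have := @rademacher_laplace_lower R n (fun i j => s * N i j) (t / 2).
  rewrite -mulr_sumr; apply; first lra.
  - by move=> i j; rewrite sN.
  - by apply: psdfZ => //; exact: ltW.
  - by move=> x; rewrite qformZ -snu -mulrA ler_pM2l.
apply: (@markov_prob _ _ (fun z : {ffun 'I_m -> {ffun 'I_n -> bool}} => expR (\sum_k (- 1 * qform (fun i j => s * N i j) (sgv R (z k)) / 2)))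
  _ (expR (- ((1 - t) * (s * (m%:R * tr)) / 2)))).
- exact: expR_gt0.
- by move=> z; exact: expR_ge0.
- move=> z h; rewrite ler_expR.
  under eq_bigr do rewrite qformZ mulN1r mulNr -mulrA mulrCA mulrA.
  rewrite sumrN -mulr_suml lerN2.
  rewrite ler_pM2r ?invr_gt0// -mulr_suml mulrC mulrCA.
  by rewrite ler_pM2l.
- rewrite (expect_expR_sum _ (fun z => - 1 * qform (fun i j => s * N i j) (sgv R z) / 2)).
  apply: (@le_trans _ _ (expR (- ((1 - t / 2) * (s * tr) / 2)) ^+ m)).
    by apply: lerXn2r; rewrite ?nnegrE ?expR_ge0 ?expect_ge0// => z; exact: expR_ge0.
  rewrite -expRM_natl -expRD ler_expR -mulr_natl le_eqVlt; apply/orP; left; apply/eqP.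
  by rewrite /s; field; lra.
Qed.

Lemma prob_qform_upper n m (N : 'I_n -> 'I_n -> R) (tau t : R) :
  0 < tau -> 0 < t <= 1 -> symf N -> psdf N -> \sum_i N i i <= tau ->
  prob R (fun z : {ffun 'I_m -> {ffun 'I_n -> bool}} =>
          (1 + t) * (m%:R * tau) <= \sum_k qform N (sgv R (z k)))
  <= expR (- (m%:R * t ^+ 2 / 16)).
Proof.
move=> tau0 /andP[t0 t1] sN pN leN; set tr := \sum_i N i i in leN.
have tr0 : 0 <= tr by apply: sumr_ge0 => i _; exact: psdf_diag.
pose s := t / (4 * tau); have s0 : 0 < s by rewrite divr_gt0// mulr_gt0.
have str : s * tr <= t / 4.
  by apply: (le_trans (ler_wpM2l (ltW s0) leN)); rewrite /s le_eqVlt; apply/orP; left; apply/eqP; field; lra.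
(* With [u = t / 4], the polynomial [u + 2 * u ^+ 2] dominates [(1 - u)^-1 - 1], because [u] is at
   most [1 / 4]. *)
pose y := t / 4 + 2 * (t / 4) ^+ 2.
have L2 : expect (fun z : {ffun 'I_n -> bool} =>
    expR (1 * qform (fun i j => s * N i j) (sgv R z) / 2)) <= expR (y / 2).
  have := @rademacher_laplace_upper R n (fun i j => s * N i j).
  rewrite /= -mulr_sumr -/tr => H; apply: le_trans.
    apply: H; [by move=> i j; rewrite sN|exact: psdfZ (ltW s0) pN|lra].
  rewrite ler_expR ler_pM2r ?invr_gt0// lerBlDr -[leLHS]mul1r ler_pdivrMr; last lra.
  have h : 0 <= y + 1 by rewrite /y; have := sqr_ge0 (t / 4); lra.
  apply: (@le_trans _ _ ((y + 1) * (1 - t / 4))); last by rewrite ler_wpM2l//; lra.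
  rewrite /y; set u := t / 4.
  have u0 : 0 <= u by rewrite /u; lra.
  have u4 : u <= 1 / 4 by rewrite /u; lra.
  have := mulr_ge0 (sqr_ge0 u) u0; have := ler_wpM2l (sqr_ge0 u) u4; nra.
apply: (@markov_prob _ _ (fun z : {ffun 'I_m -> {ffun 'I_n -> bool}} => expR (\sum_k (1 * qform (fun i j => s * N i j) (sgv R (z k)) / 2)))
  _ (expR ((1 + t) * (s * (m%:R * tau)) / 2))).
- exact: expR_gt0.
- by move=> z; exact: expR_ge0.
- move=> z h; rewrite ler_expR.
  under eq_bigr do rewrite qformZ mul1r -mulrA mulrCA mulrA.
  rewrite -mulr_suml ler_pM2r ?invr_gt0//.
  rewrite -mulr_suml [leRHS]mulrC mulrCA.
  by rewrite ler_pM2l.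
- rewrite (expect_expR_sum _ (fun z => 1 * qform (fun i j => s * N i j) (sgv R z) / 2)).
  apply: (@le_trans _ _ (expR (y / 2) ^+ m)).
    by apply: lerXn2r; rewrite ?nnegrE ?expR_ge0 ?expect_ge0// => z; exact: expR_ge0.
  rewrite -expRM_natl -expRD ler_expR -mulr_natl le_eqVlt; apply/orP; left; apply/eqP.
  by rewrite /s /y; field; lra.
Qed.

Definition lincomb n (v : 'I_n -> R) (z : {ffun 'I_n -> bool}) : R :=
  \sum_i v i * sgv R z i.

Lemma lincomb_fcons n (v : 'I_n.+1 -> R) b (z : {ffun 'I_n -> bool}) :
  lincomb v (fcons b z) = v ord0 * (-1) ^+ b + lincomb (fun j => v (lift ord0 j)) z.
Proof.
rewrite /lincomb big_ord_recl sgv_fcons vcons0; congr (_ + _).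
by apply: eq_bigr => i _; rewrite sgv_fcons vconsS.
Qed.

Lemma expect_lincomb2 n (t v : 'I_n -> R) :
  expect (fun z => lincomb t z * lincomb v z) = \sum_i t i * v i.
Proof.
elim: n t v => [|n IH] t v.
  have z0 : {ffun 'I_0 -> bool} by apply: finfun; case.
  by rewrite (expect_ffun0 _ z0) /lincomb !big_ord0 mul0r.
rewrite expect_fcons expect_bool -expectD -expectZr big_ord_recl -IH.
rewrite -[X in X + _](@expect_cst _ {ffun 'I_n -> bool}) ?card_sign// -expectD.
by apply: eq_expect => z; rewrite !lincomb_fcons expr0 expr1; field.
Qed.

(** For Gaussian entries the right side is the exact value (Isserlis). Signs only lose
    [2 * \sum_i t i ^+ 2 * v i ^+ 2]. *)
Lemma expect_lincomb4_le n (t v : 'I_n -> R) :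
  expect (fun z => (lincomb t z * lincomb v z) ^+ 2)
  <= (\sum_i t i ^+ 2) * (\sum_i v i ^+ 2) + 2 * (\sum_i t i * v i) ^+ 2.
Proof.
elim: n t v => [|n IH] t v.
  have z0 : {ffun 'I_0 -> bool} by apply: finfun; case.
  by rewrite (expect_ffun0 _ z0) /lincomb !big_ord0 !mul0r expr0n mulr0 addr0.
rewrite expect_fcons expect_bool -expectD -expectZr !big_ord_recl.
pose t' j := t (lift ord0 j); pose v' j := v (lift ord0 j).
rewrite (eq_expect (g := fun z => t ord0 ^+ 2 * v ord0 ^+ 2
  + (t ord0 ^+ 2 * (lincomb v' z * lincomb v' z)
  + (v ord0 ^+ 2 * (lincomb t' z * lincomb t' z)
  + (4 * (t ord0 * v ord0) * (lincomb t' z * lincomb v' z)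
  + (lincomb t' z * lincomb v' z) ^+ 2))))); last first.
  by move=> z; rewrite !lincomb_fcons expr0 expr1 -/t' -/v'; field.
rewrite !expectD !expectZ !expect_lincomb2 expect_cst ?card_sign//.
have := IH t' v'; rewrite -/t' -/v'.
have Q (u : 'I_n -> R) : \sum_i u i * u i = \sum_i u i ^+ 2.
  by apply: eq_bigr => i _; rewrite expr2.
rewrite !Q.
rewrite -[\sum_(i < n) t (lift ord0 i) ^+ 2]/(\sum_i t' i ^+ 2).
rewrite -[\sum_(i < n) v (lift ord0 i) ^+ 2]/(\sum_i v' i ^+ 2).
rewrite -[\sum_(i < n) t (lift ord0 i) * v (lift ord0 i)]/(\sum_i t' i * v' i).
set T := \sum_i t' i ^+ 2; set V := \sum_i v' i ^+ 2; set W := \sum_i t' i * v' i.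
set E := expect _ => h; rewrite -/E; move: E h => E h; nra.
Qed.

End RademacherTails.

(** * The squared Frobenius norm of rectangular matrices *)

Section FrobeniusNorm.
Variable R : realType.

Definition fsq m n (M : 'M[R]_(m, n)) : R := \sum_i \sum_j M i j ^+ 2.

Lemma fsq_ge0 m n (M : 'M[R]_(m, n)) : 0 <= fsq M.
Proof. by apply: sumr_ge0 => i _; apply: sumr_ge0 => j _; exact: sqr_ge0. Qed.

Lemma fsqE m n (M : 'M[R]_(m, n)) : fsq M = \tr (M *m M^T).
Proof.
apply: eq_bigr => i _; rewrite mxE; apply: eq_bigr => j _.
by rewrite mxE expr2.
Qed.

Lemma fsqT m n (M : 'M[R]_(m, n)) : fsq M^T = fsq M.
Proof. by rewrite !fsqE trmxK mxtrace_mulC. Qed.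

Lemma fsqN m n (M : 'M[R]_(m, n)) : fsq (- M) = fsq M.
Proof. by rewrite !fsqE linearN mulmxN mulNmx opprK. Qed.

Lemma fsqD m n (A B : 'M[R]_(m, n)) : fsq (A + B) = fsq A + fsq B + 2 * \tr (A^T *m B).
Proof.
rewrite !fsqE linearD mulmxDl !mulmxDr !linearD /=.
have -> : \tr (A *m B^T) = \tr (A^T *m B).
  by rewrite -mxtrace_tr trmx_mul trmxK mxtrace_mulC.
have -> : \tr (B *m A^T) = \tr (A^T *m B) by rewrite mxtrace_mulC.
ring.
Qed.

Lemma fsqZ m n c (A : 'M[R]_(m, n)) : fsq (c *: A) = c ^+ 2 * fsq A.
Proof.
rewrite /fsq mulr_sumr; apply: eq_bigr => i _; rewrite mulr_sumr.
by apply: eq_bigr => j _; rewrite mxE exprMn.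
Qed.

Lemma fsq_eq0 m n (A : 'M[R]_(m, n)) : (fsq A == 0) = (A == 0).
Proof.
apply/eqP/eqP => [|->]; last first.
  by rewrite /fsq big1// => i _; rewrite big1// => j _; rewrite mxE expr0n.
move=> A0; apply/matrixP => i j; rewrite mxE.
have s0 k : 0 <= \sum_l A k l ^+ 2 by apply: sumr_ge0 => l _; exact: sqr_ge0.
have := psumr_eq0P (fun k _ => s0 k) A0 => /(_ i isT).
by move=> /psumr_eq0P => /(_ (fun l _ => sqr_ge0 _)) /(_ j isT) /eqP; rewrite sqrf_eq0 => /eqP.
Qed.

Lemma fsq_mul_orth m n p (M : 'M[R]_(m, n)) (Q : 'M[R]_(n, p)) :
  Q *m Q^T = 1%:M -> fsq (M *m Q) = fsq M.
Proof. by move=> QQ; rewrite !fsqE trmx_mul mulmxA -(mulmxA M) QQ mulmx1. Qed.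

Lemma cauchy_schwarz (I : finType) (a b : I -> R) :
  (\sum_i a i * b i) ^+ 2 <= (\sum_i a i ^+ 2) * (\sum_i b i ^+ 2).
Proof.
set P := \sum_i a i * b i; set A := \sum_i a i ^+ 2; set B := \sum_i b i ^+ 2.
have H x y : 0 <= x ^+ 2 * A + 2 * x * y * P + y ^+ 2 * B.
  have -> : x ^+ 2 * A + 2 * x * y * P + y ^+ 2 * B = \sum_i (x * a i + y * b i) ^+ 2.
    rewrite !mulr_sumr -!big_split /=; apply: eq_bigr => i _; ring.
  by apply: sumr_ge0 => i _; exact: sqr_ge0.
have A0 : 0 <= A by apply: sumr_ge0 => i _; exact: sqr_ge0.
have [Ap|A_0] := ltP 0 A.
  have := H (- P) A; have -> : (- P) ^+ 2 * A + 2 * - P * A * P + A ^+ 2 * B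
    = A * (A * B - P ^+ 2) by ring.
  by rewrite pmulr_rge0// subr_ge0.
have := H (- (B + 1)) P; have := H 1 0.
have -> : A = 0 by lra.
have B0 : 0 <= B by apply: sumr_ge0 => i _; exact: sqr_ge0.
by have := sqr_ge0 P; have := mulr_ge0 B0 (sqr_ge0 P); nra.
Qed.

Lemma fsq_mul_le m n p (A : 'M[R]_(m, n)) (B : 'M[R]_(n, p)) :
  fsq (A *m B) <= fsq A * fsq B.
Proof.
rewrite -[fsq B]fsqT /fsq mulr_suml; apply: ler_sum => i _.
rewrite mulr_sumr; apply: ler_sum => j _.
rewrite mxE; apply: (le_trans (cauchy_schwarz _ _)).
by rewrite ler_wpM2l ?sumr_ge0// => [k _|]; rewrite ?sqr_ge0// ler_sum// => k _; rewrite mxE.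
Qed.

Lemma frobE n (A : 'M[R]_n) : frob A = Num.sqrt (fsq A).
Proof. by []. Qed.

Lemma frob_ge0 n (A : 'M[R]_n) : 0 <= frob A.
Proof. exact: sqrtr_ge0. Qed.

Lemma frob_sqr n (A : 'M[R]_n) : frob A ^+ 2 = fsq A.
Proof. by rewrite sqr_sqrtr// fsq_ge0. Qed.

Lemma frobN n (A : 'M[R]_n) : frob (- A) = frob A.
Proof. by rewrite !frobE fsqN. Qed.

Lemma frobB n (A B : 'M[R]_n) : frob (A - B) = frob (B - A).
Proof. by rewrite -frobN opprB. Qed.

Lemma ler_frobD n (A B : 'M[R]_n) : frob (A + B) <= frob A + frob B.
Proof.
rewrite -(@ler_pXn2r _ 2)// ?nnegrE ?addr_ge0 ?frob_ge0//.
rewrite sqrrD !frob_sqr fsqD -addrA [in leRHS]addrAC -addrA lerD2l lerD2l.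
rewrite -[leRHS]mulr_natl ler_pM2l// -[leRHS]ger0_norm ?mulr_ge0 ?frob_ge0//.
rewrite (le_trans (ler_norm _))// -ler_sqr ?nnegrE// !real_normK ?num_real//.
rewrite exprMn !frob_sqr /mxtrace /fsq !pair_bigA /=.
apply: le_trans (cauchy_schwarz _ _).
under eq_bigr do rewrite mxE.
rewrite exchange_big pair_bigA /= le_eqVlt; apply/orP; left; apply/eqP.
by congr (_ ^+ 2); apply: eq_bigr => -[i j] _; rewrite !mxE.
Qed.

End FrobeniusNorm.

(** * The spectral theorem for real symmetric matrices *)

Section Spectral.
Variable R : realType.

(** A complex eigenvector [x + i y] exists over the algebraic closure. Comparing [x S y^T] with
    [y S x^T] gives [Im a * (fsq x + fsq y) = 0], so the eigenvalue is real and whichever of [x],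
    [y] is nonzero is an eigenvector. *)
Lemma symmetric_eigenvector n (S : 'M[R]_n.+1) : S^T = S ->
  exists a (v : 'rV[R]_n.+1), v != 0 /\ v *m S = a *: v.
Proof.
move=> symS; have [a /eigenvalueP[v vS v0]] :=
  spectral.eigenvalue_closed (map_mx (real_complex R) S) isT.
pose x := map_mx (@complex.Re R) v; pose y := map_mx (@complex.Im R) v.
have xS : x *m S = complex.Re a *: x - complex.Im a *: y.
  apply/rowP => j; move/rowP/(_ j): vS => /(congr1 (@complex.Re R)).
  rewrite !mxE raddf_sum /=; case: a => a1 a2 /= => E.
  rewrite -[RHS](_ : complex.Re ((a1 +i* a2)%C * v 0 j) = _); last by case: (v 0 j).
  rewrite -E; apply: eq_bigr => k _; rewrite !mxE.
  by case: (v 0 k) => c d /=; rewrite mulr0 subr0.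
have yS : y *m S = complex.Im a *: x + complex.Re a *: y.
  apply/rowP => j; move/rowP/(_ j): vS => /(congr1 (@complex.Im R)).
  rewrite !mxE raddf_sum /=; case: a {xS} => a1 a2 /= => E.
  rewrite -[RHS](_ : complex.Im ((a1 +i* a2)%C * v 0 j) = _); last first.
    by case: (v 0 j) => c d /=; rewrite addrC.
  rewrite -E; apply: eq_bigr => k _; rewrite !mxE.
  by case: (v 0 k) => c d /=; rewrite mulr0 add0r.
have xy : x != 0 \/ y != 0.
  have [x0|] := eqVneq x 0; last by left.
  have [y0|] := eqVneq y 0; last by right.
  case/eqP: v0; apply/rowP => j; rewrite mxE.
  move/rowP/(_ j): x0; move/rowP/(_ j): y0; rewrite !mxE.
  by case: (v 0 j) => c d /= -> ->.
have fxy : 0 < fsq x + fsq y.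
  case: xy; rewrite -fsq_eq0 => h.
    by rewrite ltr_wpDr ?fsq_ge0// lt_neqAle eq_sym h fsq_ge0.
  by rewrite ltr_wpDl ?fsq_ge0// lt_neqAle eq_sym h fsq_ge0.
have E : \tr (x *m S *m y^T) = \tr (y *m S *m x^T).
  by rewrite -mxtrace_tr !trmx_mul trmxK symS mulmxA.
have a0 : complex.Im a = 0.
  move: E; rewrite xS yS mulmxBl mulmxDl -!scalemxAl linearB linearD !linearZ /= -!fsqE.
  have -> : \tr (x *m y^T) = \tr (y *m x^T) by rewrite -mxtrace_tr trmx_mul trmxK.
  set t := \tr _ => E.
  have {}E : complex.Re a * t + complex.Im a * - fsq y = complex.Im a * fsq x + complex.Re a * t := E.
  have : complex.Im a * (fsq x + fsq y) = 0 by lra.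
  by move=> /eqP; rewrite mulf_eq0 (gt_eqF fxy) orbF => /eqP.
case: xy => h; exists (complex.Re a).
  by exists x; rewrite h xS a0 scale0r subr0.
by exists y; rewrite h yS a0 scale0r add0r.
Qed.

(* [H] is the Householder reflection exchanging the first basis vector and [v]. *)
Lemma orthogonal_extension n (v : 'rV[R]_n.+1) : fsq v = 1 ->
  exists H : 'M[R]_n.+1, [/\ H^T = H, H *m H = 1%:M & row 0 H = v].
Proof.
move=> v1; pose e := delta_mx 0 0 : 'rV[R]_n.+1; pose w := v - e.
have rowE (H : 'M[R]_n.+1) : row 0 H = e *m H by rewrite -rowE.
have [w0|wN0] := eqVneq w 0.
  exists 1%:M; rewrite trmx1 mulmx1 rowE mulmx1; split=> //.
  by apply/esym/eqP; rewrite -subr_eq0 -/w w0.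
have fe : fsq e = 1.
  rewrite /fsq big_ord1 (bigD1 ord0)//= mxE !eqxx expr1n big1 ?addr0// => j /negbTE j0.
  by rewrite mxE j0 expr0n.
have wwT : w *m w^T = (fsq w)%:M.
  rewrite fsqE [LHS]mx11_scalar; congr _%:M; by rewrite /mxtrace big_ord1.
have ewT : e *m w^T = (- (fsq w / 2))%:M.
  rewrite [LHS]mx11_scalar; congr _%:M.
  have : fsq v = fsq (w + e) by rewrite subrK.
  rewrite fsqD fe v1.
  have -> : \tr (w^T *m e) = (e *m w^T) 0 0 by rewrite mxtrace_mulC /mxtrace big_ord1.
  by lra.
have fw : fsq w != 0 by rewrite fsq_eq0.
pose c := 2 / fsq w; exists (1%:M - c *: (w^T *m w)); split.
- by rewrite linearB linearZ /= trmx1 trmx_mul trmxK.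
- have : (w^T *m w) *m (w^T *m w) = fsq w *: (w^T *m w).
    by rewrite mulmxA -(mulmxA w^T w) wwT mul_mx_scalar -scalemxAl.
  move: (w^T *m w) => P PP.
  rewrite mulmxBl mul1mx mulmxBr mulmx1 -scalemxAl -scalemxAr PP !scalerA.
  have -> : c * c * fsq w = c + c by rewrite /c; field.
  by rewrite scalerDl opprB addrK subrK.
- rewrite rowE mulmxBr mulmx1 -scalemxAr mulmxA ewT mul_scalar_mx scalerA.
  have -> : c * - (fsq w / 2) = -1 by rewrite /c; field.
  by rewrite scaleN1r opprK addrC subrK.
Qed.

(** Deflation: a reflection moves a unit eigenvector to the first basis vector, symmetry makes the
    conjugated matrix block diagonal, and the induction hypothesis treats the lower block. *)
Theorem real_spectral n (S : 'M[R]_n) : S^T = S ->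
  exists (Q : 'M[R]_n) (d : 'rV[R]_n),
    Q *m Q^T = 1%:M /\ S = Q *m diag_mx d *m Q^T.
Proof.
elim: n S => [|n IH] S symS.
  by exists 1%:M, 0; rewrite trmx1 mulmx1; split=> //; apply/matrixP => -[].
have [a [u [u0 uS]]] := symmetric_eigenvector symS.
pose v := (Num.sqrt (fsq u))^-1 *: u.
have fu : 0 < fsq u by rewrite lt_neqAle eq_sym fsq_eq0 u0 fsq_ge0.
have v1 : fsq v = 1.
  by rewrite fsqZ exprVn sqr_sqrtr ?fsq_ge0// mulVf// gt_eqF.
have vS : v *m S = a *: v by rewrite -scalemxAl uS !scalerA mulrC.
(* The dimension is written [1 + n], convertible to [n.+1], so that block operations apply. *)
have [H [symH HH rH]] : exists H : 'M[R]_(1 + n),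
  [/\ H^T = H, H *m H = 1%:M & row 0 H = v] := orthogonal_extension v1.
have [B defB] : exists B : 'M[R]_(1 + n), B = H *m S *m H by exists (H *m S *m H).
have symB : B^T = B by rewrite defB !trmx_mul symH symS mulmxA.
have rB : row 0 B = a *: delta_mx 0 0.
  rewrite defB !row_mul rH vS -scalemxAl -rH -row_mul HH.
  by congr (_ *: _); apply/rowP => j; rewrite !mxE eqxx eq_sym.
have Bul : ulsubmx B = a%:M.
  apply/matrixP => i j; rewrite !ord1 !mxE; move/rowP/(_ 0): rB; rewrite !mxE.
  by rewrite !eqxx mulr1 mulr1n => <-; congr (B _ _); apply/val_inj.
have Bur : ursubmx B = 0.
  apply/matrixP => i j; rewrite !ord1 !mxE; move/rowP/(_ (rshift 1 j)): rB; rewrite !mxE.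
  by rewrite andbF mulr0 => <-; congr (B _ _); apply/val_inj.
have Bdl : dlsubmx B = 0 by rewrite -[B]symB -trmx_ursub Bur trmx0.
have symS' : (drsubmx B)^T = drsubmx B by rewrite trmx_drsub symB.
have [Q' [d' [QQ SE]]] := IH _ symS'.
have BE : B = block_mx a%:M 0 0 (Q' *m diag_mx d' *m Q'^T).
  by rewrite -SE -[LHS]submxK Bul Bur Bdl.
pose K : 'M[R]_(1 + n) := block_mx 1%:M 0 0 Q'.
have KK : K *m K^T = 1%:M.
  rewrite /K tr_block_mx mulmx_block !trmx0 !trmx1.
  by rewrite !(mul0mx, mulmx0, mulmx1, addr0, add0r) QQ -scalar_mx_block.
have KB : K *m diag_mx (row_mx a%:M d') *m K^T = B.
  rewrite BE /K diag_mx_row tr_block_mx !mulmx_block.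
  rewrite !trmx0 !trmx1 !(mul0mx, mulmx0, mulmx1, mul1mx, addr0, add0r).
  by congr block_mx; apply/matrixP => i j; rewrite !mxE !ord1.
exists (H *m K), (row_mx a%:M d'); split.
  by rewrite trmx_mul mulmxA -(mulmxA H) KK mulmx1 symH.
rewrite trmx_mul symH mulmxA -(mulmxA H K) -(mulmxA H) KB defB.
by rewrite !mulmxA HH mul1mx -mulmxA HH mulmx1.
Qed.

End Spectral.

(** * Sign sketches, and splitting a matrix at a level of its spectrum *)

Section SpectralSplit.
Variable R : realType.

Definition sgmx n m (z : {ffun 'I_m -> {ffun 'I_n -> bool}}) : 'M[R]_(n, m) :=
  \matrix_(i, k) sgv R (z k) i.

Definition gram n k (M : 'M[R]_(k, n)) (i j : 'I_n) : R := (M^T *m M) i j.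

Lemma qform_gram n k (M : 'M[R]_(k, n)) x :
  qform (gram M) x = \sum_i (\sum_j M i j * x j) ^+ 2.
Proof.
rewrite /qform /gram.
under eq_bigr do under eq_bigr do rewrite mxE mulr_suml.
under eq_bigr do rewrite exchange_big.
rewrite exchange_big /=; apply: eq_bigr => l _.
rewrite expr2 mulr_suml; apply: eq_bigr => i _.
by rewrite mulr_sumr; apply: eq_bigr => j _; rewrite mxE; ring.
Qed.

Lemma symf_mx n (S : 'M[R]_n) : S^T = S -> symf (fun i j => S i j).
Proof. by move=> SS i j; have /matrixP/(_ j i) := SS; rewrite mxE. Qed.

Lemma symf_gram n k (M : 'M[R]_(k, n)) : symf (gram M).
Proof. by apply: symf_mx; rewrite trmx_mul trmxK. Qed.

Lemma psdf_gram n k (M : 'M[R]_(k, n)) : psdf (gram M).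
Proof. by move=> x; rewrite qform_gram sumr_ge0// => i _; exact: sqr_ge0. Qed.

Lemma trace_gram n k (M : 'M[R]_(k, n)) : \sum_i gram M i i = fsq M.
Proof. by rewrite -fsqT fsqE trmxK. Qed.

Lemma fsq_mul_sgmx n k m (M : 'M[R]_(k, n)) (z : {ffun 'I_m -> {ffun 'I_n -> bool}}) :
  fsq (M *m sgmx z) = \sum_l qform (gram M) (sgv R (z l)).
Proof.
rewrite /fsq exchange_big /=; apply: eq_bigr => l _; rewrite qform_gram.
apply: eq_bigr => i _; rewrite mxE; congr (_ ^+ 2).
by apply: eq_bigr => j _; rewrite mxE.
Qed.

Lemma qform_diag n (Q : 'M[R]_n) (d : 'rV[R]_n) x :
  qform (fun i j => (Q *m diag_mx d *m Q^T) i j) x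
  = \sum_i d 0 i * (\sum_j Q j i * x j) ^+ 2.
Proof.
rewrite /qform.
under eq_bigr do under eq_bigr do rewrite mul_mx_diag mxE mulr_suml.
under eq_bigr do rewrite exchange_big.
rewrite exchange_big /=; apply: eq_bigr => l _.
rewrite expr2 mulr_suml mulr_sumr; apply: eq_bigr => i _.
by rewrite !mulr_sumr; apply: eq_bigr => j _; rewrite !mxE; ring.
Qed.

Lemma sum_sqr_orth n (Q : 'M[R]_n) (x : 'I_n -> R) : Q *m Q^T = 1%:M ->
  \sum_i (\sum_j Q j i * x j) ^+ 2 = \sum_i x i ^+ 2.
Proof.
move=> QQ; have := fsq_mul_orth (\row_i x i) QQ; rewrite /fsq !big_ord1.
under [in RHS]eq_bigr do rewrite mxE.
move=> <-; apply: eq_bigr => i _; rewrite mxE; congr (_ ^+ 2).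
by apply: eq_bigr => j _; rewrite mxE mulrC.
Qed.

(** Right multiplication by this matrix keeps exactly the columns with index in [A]. *)
Definition selmx n (A : {set 'I_n}) : 'M[R]_(n, #|A|) :=
  \matrix_(i, k) (i == enum_val k)%:R.

Lemma mulmx_selmxT n (A : {set 'I_n}) :
  selmx A *m (selmx A)^T = diag_mx (\row_i (i \in A)%:R).
Proof.
apply/matrixP => i j; rewrite mxE.
under eq_bigr do rewrite !mxE.
rewrite -(@big_enum_val _ _ _ _ (mem A) (fun x => (i == x)%:R * (j == x)%:R)) !mxE /=.
case: (boolP (i \in A)) => iA; last first.
  rewrite mul0rn big1// => x xA; case: eqVneq => [ix|]; rewrite ?mul0r//.
  by rewrite -ix (negbTE iA) in xA.
rewrite (bigD1 i)//= eqxx mul1r big1 ?addr0 => [|x /andP[_ /negbTE xi]].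
  by rewrite eq_sym; case: eqP.
by rewrite eq_sym xi mul0r.
Qed.

Lemma mulTmx_selmx n (A : {set 'I_n}) : (selmx A)^T *m selmx A = 1%:M.
Proof.
apply/matrixP => k l; rewrite mxE.
under eq_bigr do rewrite !mxE.
rewrite (bigD1 (enum_val k))//= eqxx mul1r big1 ?addr0 => [|x /negbTE ->]; last by rewrite mul0r.
by rewrite (inj_eq enum_val_inj) !mxE.
Qed.

(* [tau] is the energy of [E] after clipping the squared singular values at
   [mu]; [V] spans the right singular vectors above the clipping level. *)
Lemma clipped_spectrum n (E : 'M[R]_n) (mu : R) : 0 < mu ->
  exists tau d (V : 'M[R]_(n, d)),
  [/\ forall m (t : R), 0 < t <= 1 ->
        prob R (fun z : {ffun 'I_m -> {ffun 'I_n -> bool}} =>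
                fsq (E *m sgmx z) <= (1 - t) * (m%:R * tau))
        <= expR (- (m%:R * t ^+ 2 * tau / (8 * mu))),
      V^T *m V = 1%:M, d%:R * mu <= tau & fsq (E - E *m V *m V^T) <= tau].
Proof.
move=> mu0; have symG : (E^T *m E)^T = E^T *m E by rewrite trmx_mul trmxK.
have [Q [d [QQ GE]]] := real_spectral symG.
have QtQ : Q^T *m Q = 1%:M by apply: mulmx1C.
(* The eigenvalues are squared column norms of [E *m Q]; this gives their sign here and the energy
   of the tail at the end. *)
have dE i : d 0 i = \sum_k (E *m Q) k i ^+ 2.
  have : diag_mx d = (E *m Q)^T *m (E *m Q).
    rewrite trmx_mul !mulmxA -(mulmxA Q^T) GE !mulmxA QtQ mul1mx.
    by rewrite -mulmxA QtQ mulmx1.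
  move=> /matrixP/(_ i i); rewrite !mxE eqxx mulr1n => ->.
  by apply: eq_bigr => k _; rewrite !mxE expr2.
have d0 i : 0 <= d 0 i by rewrite dE sumr_ge0// => k _; exact: sqr_ge0.
pose e : 'rV[R]_n := \row_i Num.min (d 0 i) mu.
have e0 i : 0 <= e 0 i by rewrite mxE le_min d0 ltW.
pose N i j := (Q *m diag_mx e *m Q^T) i j.
have trN : \sum_i N i i = \sum_i e 0 i.
  rewrite -[LHS]/(\tr (Q *m diag_mx e *m Q^T)) mxtrace_mulC mulmxA QtQ mul1mx.
  by rewrite mxtrace_diag.
pose A := [set i | mu < d 0 i]; pose V := Q *m selmx A.
exists (\sum_i e 0 i), #|A|, V; split.
(* Clipping only lowers the form, so a small sketch of [E] is a small value of the form of [N],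
   which is bounded by [mu]. *)
- move=> m t t01; rewrite -trN; apply: le_trans (prob_qform_lower _ mu0 t01 _ _ _).
  + apply: ler_prob => z h; apply: (le_trans _ h); rewrite fsq_mul_sgmx.
    apply: ler_sum => l _; rewrite qform_diag.
    have -> : qform (gram E) (sgv R (z l)) = qform (fun i j => (Q *m diag_mx d *m Q^T) i j) (sgv R (z l)).
      by rewrite /gram GE.
    rewrite qform_diag; apply: ler_sum => i _; rewrite ler_wpM2r ?sqr_ge0// mxE.
    by rewrite ge_min lexx.
  + by apply: symf_mx; rewrite !trmx_mul trmxK tr_diag_mx mulmxA.
  + by move=> x; rewrite qform_diag sumr_ge0// => i _; rewrite mulr_ge0// sqr_ge0.
  + move=> x; rewrite qform_diag -(sum_sqr_orth x QQ) mulr_sumr.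
    apply: ler_sum => i _; rewrite ler_wpM2r ?sqr_ge0// mxE.
    by rewrite ge_min lexx orbT.
- by rewrite /V trmx_mul mulmxA -(mulmxA _ Q^T) QtQ mulmx1 mulTmx_selmx.
(* Each direction kept in [V] contributes exactly [mu] to the clipped trace. *)
- rewrite (bigID (fun i => i \in A)) /= -[leLHS]addr0 lerD// ?sumr_ge0//.
  rewrite mulrC mulr_natr -sumr_const ler_sum// => i.
  by rewrite inE mxE => /ltW mud; rewrite le_min mud lexx.
(* In the basis [Q] the projection erases the columns in [A]; on the others clipping changes
   nothing. *)
- rewrite -(fsq_mul_orth (E - E *m V *m V^T) QQ).
  have -> : (E - E *m V *m V^T) *m Q = E *m Q *m diag_mx (\row_i (i \notin A)%:R).
    rewrite mulmxBl /V trmx_mul -!mulmxA QtQ mulmx1.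
    rewrite mulmx_selmxT !mulmxA -[X in X - _]mulmx1 -mulmxBr; congr (_ *m _).
    apply/matrixP => i j; rewrite !mxE; case: eqVneq => _; rewrite ?mulr0n ?subr0//.
    by case: (i \in A); rewrite ?subrr ?subr0.
  rewrite mul_mx_diag /fsq exchange_big /=; apply: ler_sum => i _.
  under eq_bigr do rewrite mxE [X in _ * X]mxE exprMn.
  rewrite -mulr_suml -dE mxE inE; case: ltP => dmu /=; first by rewrite expr0n mulr0 ltW.
  by rewrite expr1n mulr1.
Qed.

End SpectralSplit.

(** * Sketched regression onto the heavy singular directions *)

Section SubspaceEmbedding.
Variable R : realType.

Lemma fsqD_le m n (A B : 'M[R]_(m, n)) : fsq (A + B) <= 2 * fsq A + 2 * fsq B.
Proof. by have := fsq_ge0 (A - B); rewrite !fsqD fsqN mulmxN linearN /=; lra. Qed.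

Lemma fsq_cols m n (M : 'M[R]_(m, n)) : fsq M = \sum_j fsq (col j M).
Proof.
rewrite /fsq exchange_big /=; apply: eq_bigr => j _.
by apply: eq_bigr => i _; rewrite big_ord1 mxE.
Qed.

(** The witness [Z^T V S^-1 V^T], with [S = V^T Z Z^T V], reproduces the heavy part [E V V^T]
    exactly. What remains is [T] minus a matrix whose rows lie in the span of the columns of [V]. As
    [T V = 0], the two are orthogonal and their energies add. *)
Lemma sketched_regression n d p (E : 'M[R]_n) (V : 'M[R]_(n, d)) (Z : 'M[R]_(n, p))
    (c b : R) :
  let T := E - E *m V *m V^T in
  V^T *m V = 1%:M -> 0 < c ->
  (forall x : 'cV[R]_d, c * fsq x <= fsq (Z^T *m V *m x)) ->
  fsq (T *m Z *m Z^T *m V) <= b ->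
  exists X : 'M[R]_(p, n), fsq (E - E *m Z *m X) <= fsq T + b / c ^+ 2.
Proof.
move=> T VV c0 Zc Tb.
have ZcM k (M : 'M[R]_(d, k)) : c * fsq M <= fsq (Z^T *m V *m M).
  rewrite fsq_cols [leRHS]fsq_cols mulr_sumr; apply: ler_sum => j _.
  by rewrite [col j (_ *m _)]colE -mulmxA -colE.
pose S := V^T *m Z *m Z^T *m V.
have SE k (M : 'M[R]_(k, d)) : fsq (Z^T *m V *m M^T) = \tr (M *m S *m M^T).
  by rewrite -fsqT fsqE /S !trmx_mul !trmxK !mulmxA.
have Su : S \in unitmx.
  rewrite -row_free_unit -kermx_eq0 -fsq_eq0 eq_le fsq_ge0 andbT.
  have := ZcM _ (kermx S)^T.
  by rewrite SE mulmx_ker mul0mx mxtrace0 fsqT pmulr_rle0.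
(* The inverse of [S] has norm at most [c^-1]: expand [0 <= fsq (M - c *: M')] and use the
   coercivity [c * fsq M' <= \tr (M *m M'^T)]. *)
have Sinv k (M : 'M[R]_(k, d)) : fsq (M *m invmx S) <= fsq M / c ^+ 2.
  set M' := M *m invmx S.
  have := ZcM _ M'^T; rewrite SE /M' mulmxKV// -/M' fsqT.
  have := fsq_ge0 (M - c *: M'); rewrite fsqD fsqN fsqZ mulmxN linearN /= -scalemxAr linearZ /=.
  have -> : \tr (M^T *m M') = \tr (M *m M'^T).
    by rewrite -mxtrace_tr trmx_mul trmxK mxtrace_mulC.
  rewrite ler_pdivlMr ?exprn_gt0// => h1 h2.
  have := ler_wpM2l (ltW c0) h2; lra.
have TV : T *m V = 0 by rewrite /T mulmxBl -(mulmxA _ V^T V) VV mulmx1 subrr.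
exists (Z^T *m V *m invmx S *m V^T).
have -> : E - E *m Z *m (Z^T *m V *m invmx S *m V^T)
  = T + - (T *m Z *m Z^T *m V *m invmx S *m V^T).
  have {1 2}-> : E = T + E *m V *m V^T by rewrite subrK.
  rewrite !mulmxDl -[in X in _ - (_ + X)]mulmxA !mulmxA.
  have -> : E *m V *m V^T *m Z *m Z^T *m V *m invmx S = E *m V.
    by rewrite -[RHS](mulmxK Su) /S !mulmxA.
  by rewrite opprD addrACA subrr addr0.
rewrite fsqD mulmxN linearN /= [\tr (T^T *m _)]mxtrace_mulC -!mulmxA.
have -> : V^T *m T^T = 0 by rewrite -trmx_mul TV trmx0.
rewrite !mulmx0 mxtrace0 oppr0 mulr0 addr0 lerD2l fsqN !mulmxA.
rewrite fsq_mul_orth ?trmxK// (le_trans (Sinv _ _))//.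
by rewrite ler_wpM2r// invr_ge0 exprn_ge0// ltW.
Qed.

Lemma sqr_le1E (x : R) : (x ^+ 2 <= 1) = (-1 <= x <= 1).
Proof. by rewrite -ler_norml -real_normK ?num_real// expr_le1. Qed.

(** Integer points of the cube of radius [K]: after division by [K] they form an explicit finite
    net, whose cardinality is immediate. *)
Definition gridvec d K (g : {ffun 'I_d -> 'I_(2 * K).+1}) : 'cV[R]_d :=
  \col_i ((g i)%:R - K%:R).

Lemma grid_net_lower p d (M : 'M[R]_(p, d)) : (0 < d)%N ->
  fsq M <= 4 * p%:R * d%:R ->
  (forall g : {ffun 'I_d -> 'I_(2 * (12 * d)).+1},
     p%:R / 2 * fsq (gridvec g) <= fsq (M *m gridvec g)) ->
  forall x : 'cV[R]_d, p%:R / 12 * fsq x <= fsq (M *m x).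
Proof.
move=> d0 fM net x; set K := (12 * d)%N.
wlog x1 : x / fsq x = 1.
  move=> H; have [x0|xp] := eqVneq x 0.
    by rewrite x0 mulmx0 /fsq !big1 ?mulr0// => i _; rewrite big1// => j _; rewrite mxE expr0n.
  have fx : 0 < fsq x by rewrite lt_neqAle eq_sym fsq_eq0 xp fsq_ge0.
  have := H ((Num.sqrt (fsq x))^-1 *: x).
  rewrite -scalemxAr !fsqZ exprVn sqr_sqrtr ?fsq_ge0// mulVf ?gt_eqF//.
  by move=> /(_ erefl); rewrite mulr1 [X in _ <= X]mulrC ler_pdivlMr.
have x_i i : x i 0 ^+ 2 <= 1.
  rewrite -x1 /fsq (bigD1 i)//= big_ord1 lerDl sumr_ge0// => j _.
  by rewrite big_ord1 sqr_ge0.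
have xi1 i : -1 <= x i 0 <= 1 by rewrite -sqr_le1E.
have K0 : 0 <= K%:R :> R by rewrite ler0n.
(* The shift by [K] makes the rounded coordinate a natural number between 0 and [2 * K], whence
   [2 * K + 1] values. *)
pose g : {ffun 'I_d -> 'I_(2 * K).+1} := [ffun i => inord (Num.truncn (K%:R * x i 0 + K%:R))].
pose u := K%:R *: x - gridvec g.
have u1 i : u i 0 ^+ 2 <= 1.
  have := xi1 i => /andP[xl xu].
  have y0 : 0 <= K%:R * x i 0 + K%:R by have := ler_wpM2l K0 xl; lra.
  have yK : (Num.truncn (K%:R * x i 0 + K%:R)%R < (2 * K).+1)%N.
    rewrite ltnS truncn_le_nat -natr1 natrM; have := ler_wpM2l K0 xu; lra.
  have /andP[t1 t2] := truncn_itv y0.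
  rewrite sqr_le1E !mxE ffunE inordK//; rewrite -natr1 in t2.
  by apply/andP; split; lra.
have fu : fsq u <= d%:R.
  rewrite /fsq; apply: (@le_trans _ _ (\sum_(i < d) 1)).
    by apply: ler_sum => i _; rewrite big_ord1.
  by rewrite sumr_const card_ord.
have d1 : 1 <= d%:R :> R by rewrite ler1n.
have p0 : 0 <= p%:R :> R by rewrite ler0n.
have Mu : fsq (M *m u) <= 4 * p%:R * d%:R * d%:R.
  apply: (le_trans (fsq_mul_le _ _)); apply: ler_pM; rewrite ?fsq_ge0//.
have Kx : K%:R ^+ 2 <= 2 * fsq (gridvec g) + 2 * d%:R.
  have : fsq (gridvec g + u) <= 2 * fsq (gridvec g) + 2 * fsq u := fsqD_le _ _.
  by rewrite addrC subrK fsqZ x1; lra.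
have Mg : fsq (M *m gridvec g) <= 2 * (K%:R ^+ 2 * fsq (M *m x)) + 2 * fsq (M *m u).
  have := fsqD_le (K%:R *: (M *m x)) (- (M *m u)); rewrite fsqN fsqZ.
  suff -> : K%:R *: (M *m x) + - (M *m u) = M *m gridvec g by [].
  by rewrite scalemxAr -mulmxBr opprB addrC subrK.
have := net g; rewrite x1 -/K => netg.
have KE : K%:R = 12 * d%:R :> R by rewrite natrM.
rewrite KE in Kx Mg; set F := fsq (M *m x) in Mg *; set G := fsq (gridvec g) in Kx netg.
have h1 : p%:R / 2 * (72 * d%:R ^+ 2 - d%:R) <= p%:R / 2 * G.
  by rewrite ler_wpM2l ?divr_ge0//; lra.
have h2 : p%:R * d%:R <= p%:R * d%:R ^+ 2 :> R.
  by rewrite ler_wpM2l// expr2 ler_peMr//; lra.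
have D0 : 0 < d%:R ^+ 2 :> R by rewrite exprn_gt0// ltr0n.
rewrite mulr1 -(ler_pM2l D0).
have e1 : p%:R / 2 * (72 * d%:R ^+ 2 - d%:R) = 36 * (p%:R * d%:R ^+ 2) - (p%:R * d%:R) / 2 :> R.
  by field.
have e2 : 4 * p%:R * d%:R * d%:R = 4 * (p%:R * d%:R ^+ 2) :> R by ring.
have e3 : 2 * ((12 * d%:R) ^+ 2 * F) = 288 * (d%:R ^+ 2 * F) by ring.
have e4 : d%:R ^+ 2 * (p%:R / 12) = (p%:R * d%:R ^+ 2) / 12 :> R by field.
rewrite e1 in h1; rewrite e2 in Mu; rewrite e3 in Mg; rewrite e4.
have a0 : 0 <= p%:R * d%:R ^+ 2 :> R by rewrite mulr_ge0// ltW.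
move: h1 h2 Mu Mg netg a0; move: (p%:R * d%:R ^+ 2) (p%:R * d%:R) (d%:R ^+ 2 * F).
move: (p%:R / 2 * G) (fsq (M *m gridvec g)) (fsq (M *m u)); clear => *; lra.
Qed.

Lemma expect_sum_fun (U : finType) n (f : U -> R) : (0 < #|U|)%N ->
  expect (fun z : {ffun 'I_n -> U} => \sum_i f (z i)) = n%:R * expect f.
Proof.
move=> U0; elim: n => [|n IH].
  have z0 : {ffun 'I_0 -> U} by apply: finfun; case.
  by rewrite (expect_ffun0 _ z0) big_ord0 mul0r.
have cz : (0 < #|{ffun 'I_n -> U}|)%N by rewrite card_ffun expn_gt0 U0.
rewrite expect_fcons (eq_expect (g := fun u => f u + n%:R * expect f)) => [|u].
  by rewrite expectD expect_cst// -[n.+1]addn1 natrD mulrDl mul1r addrC.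
rewrite (eq_expect (g := fun z : {ffun 'I_n -> U} => f u + \sum_i f (z i))) => [|z].
  by rewrite expectD expect_cst// IH.
by rewrite big_ord_recl fcons0; congr (_ + _); apply: eq_bigr => i _; rewrite fconsS.
Qed.

Lemma expect_fsq_sgmx n k p (M : 'M[R]_(k, n)) :
  expect (fun z : {ffun 'I_p -> {ffun 'I_n -> bool}} => fsq (M *m sgmx R z))
  = p%:R * fsq M.
Proof.
rewrite (eq_expect (g := fun z : {ffun 'I_p -> {ffun 'I_n -> bool}} =>
  \sum_l (fun y => \sum_i lincomb (M i) y * lincomb (M i) y) (z l))) => [|z].
  rewrite (expect_sum_fun p (fun y => \sum_i lincomb (M i) y * lincomb (M i) y) (card_sign n)) expect_sum; congr (_ * _).
  apply: eq_bigr => i _; rewrite expect_lincomb2.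
  by apply: eq_bigr => j _; rewrite expr2.
rewrite fsq_mul_sgmx; apply: eq_bigr => l _; rewrite qform_gram.
by apply: eq_bigr => i _; rewrite expr2.
Qed.

(** Each entry is a sum of [p] independent products, centred because [T *m V = 0]. So only [p]
    variances are paid, each bounded by [expect_lincomb4_le]. *)
Lemma expect_fsq_cross n k d p (T : 'M[R]_(k, n)) (V : 'M[R]_(n, d)) : T *m V = 0 ->
  expect (fun z : {ffun 'I_p -> {ffun 'I_n -> bool}} =>
    fsq (T *m sgmx R z *m (sgmx R z)^T *m V)) <= p%:R * (fsq T * fsq V).
Proof.
move=> TV; rewrite (eq_expect (g := fun z : {ffun 'I_p -> {ffun 'I_n -> bool}} =>
  \sum_i \sum_j (\sum_l (fun y => lincomb (T i) y * lincomb (V^T j) y) (z l)) ^+ 2)) => [|z].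
  rewrite expect_sum -[fsq V]fsqT /fsq mulr_suml mulr_sumr; apply: ler_sum => i _.
  rewrite expect_sum !mulr_sumr; apply: ler_sum => j _.
  have TVij : \sum_k T i k * V^T j k = 0.
    move/matrixP/(_ i j): TV; rewrite !mxE => TVij; rewrite -[RHS]TVij.
    by apply: eq_bigr => k' _; rewrite mxE.
  rewrite (@expect_sum_sqr _ _ p (fun y => lincomb (T i) y * lincomb (V^T j) y)); last by rewrite expect_lincomb2.
  rewrite ler_wpM2l//; have := expect_lincomb4_le (T i) (V^T j).
  by rewrite TVij expr0n mulr0 addr0.
apply: eq_bigr => i _; apply: eq_bigr => j _; congr (_ ^+ 2).
rewrite -mulmxA mxE; apply: eq_bigr => l _; congr (_ * _).
  by rewrite mxE; apply: eq_bigr => k' _; rewrite mxE.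
by rewrite mxE; apply: eq_bigr => k' _; rewrite !mxE mulrC.
Qed.

(** The lower tail for a rank one form, whose effective rank is 1, with deviation [1 / 2]: the
    exponent is [p / (4 * 8)]. *)
Lemma prob_net_point n d p (V : 'M[R]_(n, d)) (x : 'cV[R]_d) : V^T *m V = 1%:M ->
  prob R (fun z : {ffun 'I_p -> {ffun 'I_n -> bool}} =>
    fsq ((sgmx R z)^T *m V *m x) < p%:R / 2 * fsq x) <= expR (- (p%:R / 32)).
Proof.
move=> VV; set w := V *m x.
have fw : fsq w = fsq x.
  by rewrite -fsqT /w trmx_mul fsq_mul_orth ?trmxK// fsqT.
have E (z : {ffun 'I_p -> {ffun 'I_n -> bool}}) : fsq ((sgmx R z)^T *m V *m x) = fsq (w^T *m sgmx R z).
  by rewrite -fsqT /w !trmx_mul trmxK mulmxA.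
have [x0|xp] := leP (fsq x) 0.
  have x_0 : fsq x = 0 by apply/eqP; rewrite eq_le x0 fsq_ge0.
  rewrite /prob (eq_expect (g := fun=> 0)) => [|z]; last first.
    by rewrite x_0 mulr0 ltNge fsq_ge0.
  by rewrite /expect big1// mul0r expR_ge0.
have := @prob_qform_lower R n p (gram w^T) (fsq x) 2^-1 xp.
have -> : - (p%:R * 2^-1 ^+ 2 * (\sum_i gram w^T i i) / (8 * fsq x)) = - (p%:R / 32).
  by rewrite trace_gram fsqT fw; field; rewrite gt_eqF.
move=> H; apply: le_trans (H _ _ _ _).
- apply: ler_prob => z; rewrite E fsq_mul_sgmx trace_gram fsqT fw => /ltW h.
  by apply: (le_trans h); rewrite le_eqVlt; apply/orP; left; apply/eqP; field.
- by rewrite invr_gt0 ltr0n invf_le1 ?ler1n.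
- exact: symf_gram.
- exact: psdf_gram.
- move=> y; rewrite qform_gram big_ord1 -fw.
  apply: (le_trans (cauchy_schwarz _ _)); rewrite ler_wpM2r//.
    by apply: sumr_ge0 => i _; exact: sqr_ge0.
  by rewrite /fsq; apply: ler_sum => i _; rewrite big_ord1 mxE.
Qed.

(** Failure needs one of three events: [A1], the sketched basis is too large ([1 / 4]); [A2], a grid
    point is contracted ([1 / 8]); [A3], the cross term is large ([1 / 8]). Otherwise
    [sketched_regression] applies with [c = p / 12], and [8 * 12 ^ 2 = 1152]. *)
Lemma prob_embedding n d p r (E : 'M[R]_n) (V : 'M[R]_(n, d)) (tau : R) :
  let T := E - E *m V *m V^T in
  V^T *m V = 1%:M -> 0 < tau -> fsq T <= tau -> (d <= r)%N -> (0 < r)%N -> (0 < p)%N ->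
  (25 * r)%:R ^+ r * expR (- (p%:R / 32)) <= 8^-1 :> R ->
  prob R (fun z : {ffun 'I_p -> {ffun 'I_n -> bool}} =>
    ~~ `[< exists X : 'M[R]_(p, n),
           fsq (E - E *m sgmx R z *m X) <= fsq T + 1152 * tau * r%:R / p%:R >]) <= 2^-1.
Proof.
move=> T VV tau0 Ttau dr r0 p0 netp.
have pp : 0 < p%:R :> R by rewrite ltr0n.
have rp : 0 < r%:R :> R by rewrite ltr0n.
(* The grid argument needs [0 < d]. Without heavy directions [T = E], and [X = 0] already works. *)
have [d0|dp] := posnP d.
  rewrite /prob (eq_expect (g := fun=> 0)) => [|z]; last first.
    rewrite (asboolT _)//; exists 0; rewrite mulmx0 subr0.
    have -> : T = E.
      rewrite /T -[RHS]subr0; congr (_ - _); apply/matrixP => i j; rewrite !mxE.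
      by rewrite big1// => k _; have := ltn_ord k; rewrite {2}d0.
    rewrite lerDl.
    exact: (divr_ge0 (mulr_ge0 (mulr_ge0 (ler0n R 1152) (ltW tau0)) (ltW rp)) (ltW pp)).
  by rewrite /expect big1// mul0r invr_ge0.
have dd : 0 < d%:R :> R by rewrite ltr0n.
have drR : d%:R <= r%:R :> R by rewrite ler_nat.
have fV : fsq V = d%:R by rewrite -fsqT fsqE trmxK VV mxtrace1.
pose A1 := fun z : {ffun 'I_p -> {ffun 'I_n -> bool}} =>
  4 * p%:R * d%:R <= fsq (V^T *m sgmx R z).
pose A2 := fun z : {ffun 'I_p -> {ffun 'I_n -> bool}} =>
  [exists g : {ffun 'I_d -> 'I_(2 * (12 * d)).+1},
   fsq ((sgmx R z)^T *m V *m gridvec g) < p%:R / 2 * fsq (gridvec g)].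
pose A3 := fun z : {ffun 'I_p -> {ffun 'I_n -> bool}} =>
  8 * p%:R * tau * r%:R <= fsq (T *m sgmx R z *m (sgmx R z)^T *m V).
have P1 : prob R A1 <= 4^-1.
  apply: (@markov_prob _ _ (fun z => fsq (V^T *m sgmx R z)) _ (4 * p%:R * d%:R)) => //.
  - by rewrite !mulr_gt0.
  - by move=> z; exact: fsq_ge0.
  - by rewrite expect_fsq_sgmx fsqT fV; lra.
have P2 : prob R A2 <= 8^-1.
  apply: (le_trans (prob_exists _ _)); apply: le_trans netp.
  apply: (@le_trans _ _ (\sum_(g : {ffun 'I_d -> 'I_(2 * (12 * d)).+1}) expR (- (p%:R / 32)))).
    by apply: ler_sum => g _; exact: prob_net_point.
  (* The net has [(24 * d + 1) ^ d] points, at most [(25 * r) ^ r]. *)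
  rewrite sumr_const card_ffun !card_ord -[leLHS]mulr_natl.
  rewrite ler_wpM2r ?expR_ge0// -natrX ler_nat.
  apply: (@leq_trans ((25 * r) ^ d)); last by rewrite leq_pexp2l// muln_gt0.
  rewrite leq_exp2r//; apply: leq_trans (leq_mul (leqnn 25) dr).
  by rewrite mulnA -addn1 (mulnDl 24 1) mul1n leq_add2l.
have P3 : prob R A3 <= 8^-1.
  apply: (@markov_prob _ _ (fun z => fsq (T *m sgmx R z *m (sgmx R z)^T *m V)) _ (8 * p%:R * tau * r%:R)) => //.
  - by rewrite !mulr_gt0.
  - by move=> z; exact: fsq_ge0.
  - apply: (le_trans (expect_fsq_cross _ _)).
      by rewrite /T mulmxBl -(mulmxA _ V^T V) VV mulmx1 subrr.
    rewrite fV.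
    have -> : 8 * p%:R * tau * r%:R * 8^-1 = p%:R * (tau * r%:R) by field.
    by rewrite ler_pM2l// ler_pM ?fsq_ge0// ltW.
apply: (@le_trans _ _ (prob R (fun z => A1 z || (A2 z || A3 z)))); last first.
  apply: (le_trans (prob_or _ _ _)); have := prob_or R A2 A3; lra.
apply: ler_prob => z; apply: contraNT; rewrite !negb_or => /and3P[nA1 nA2 nA3].
apply/asboolP.
have low : forall x : 'cV[R]_d, p%:R / 12 * fsq x <= fsq ((sgmx R z)^T *m V *m x).
  apply: grid_net_lower => //.
    by rewrite -fsqT trmx_mul trmxK ltW// ltNge.
  move=> g; rewrite leNgt; apply/negP => h.
  by move/negP: nA2; apply; apply/existsP; exists g.
have nA3' : fsq (T *m sgmx R z *m (sgmx R z)^T *m V) <= 8 * p%:R * tau * r%:R.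
  by rewrite ltW// ltNge.
have c0 : 0 < p%:R / 12 :> R by rewrite divr_gt0.
have [X XE] := sketched_regression VV c0 low nA3'.
exists X; apply: (le_trans XE); rewrite lerD2l le_eqVlt; apply/orP; left; apply/eqP.
by field; rewrite gt_eqF.
Qed.

End SubspaceEmbedding.

(** * The estimator and its failure probability *)

Section Estimator.
Variable R : realType.

Definition argmin_seq (T : Type) (f : T -> R) (x0 : T) (s : seq T) : T :=
  foldr (fun y acc => if f y <= f acc then y else acc) x0 s.

Lemma argmin_seqP (T : eqType) (f : T -> R) (x0 : T) (s : seq T) : x0 \in s ->
  argmin_seq f x0 s \in s /\ forall y, y \in s -> f (argmin_seq f x0 s) <= f y.
Proof.
move=> x0s; split.
  suff : argmin_seq f x0 s \in x0 :: s by rewrite inE => /predU1P[->|].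
  elim: s {x0s} => [|y s IH] /=; first by rewrite mem_head.
  case: ifP => _; first by rewrite !inE eqxx orbT.
  by move: IH; rewrite !inE => /orP[->//|->]; rewrite !orbT.
elim: s {x0s} => [//|y s IH] z; rewrite inE => /predU1P[->|/IH h] /=.
  by case: ifP => // /negbT; rewrite -ltNge => /ltW.
by case: ifP => // hy; exact: le_trans hy h.
Qed.

(** The solver [K] sees [E] only through [E^T *m Y]. The slack [eta] avoids proving that the least
    squares minimum is attained. *)
Definition near_lsq n k (K : 'M[R]_(n, k) -> 'M[R]_(n, k) -> 'M[R]_(k, n)) (eta : R) :=
  forall (E : 'M[R]_n) (Y : 'M[R]_(n, k)) (X : 'M[R]_(k, n)),
    fsq (E - Y *m K Y (E^T *m Y)) <= fsq (E - Y *m X) + eta.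

(* The objective depends on [E] only through [E^T *m Y], up to the constant
   [fsq E]: the left queries at the columns of [Y] are enough to minimise it. *)
Lemma near_lsq_exists n k (eta : R) : 0 < eta -> exists K, @near_lsq n k K eta.
Proof.
move=> eta0.
pose f (p : 'M[R]_(n, k) * 'M[R]_(n, k)) (X : 'M[R]_(k, n)) :=
  fsq (p.1 *m X) - 2 * \tr (p.2 *m X).
have fE E Y X : fsq (E - Y *m X) = fsq E + f (Y, E^T *m Y) X.
  by rewrite fsqD fsqN mulmxN linearN /= mulmxA /f; ring.
have /choice[K KP] : forall p, exists X, (exists E : 'M[R]_n, p.2 = E^T *m p.1) ->
    forall X', f p X <= f p X' + eta.
  move=> [Y W]; have [[E /= WE]|nE] := pselect (exists E : 'M[R]_n, W = E^T *m Y); last first.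
    by exists 0 => -[E WE]; case: nE; exists E.
  pose S := [set fsq (E - Y *m X) | X in [set: 'M[R]_(k, n)]]%classic.
  have S0 : has_inf S.
    split; first by exists (fsq (E - Y *m 0)), 0.
    by exists 0 => _ [X _ <-]; exact: fsq_ge0.
  have [_ [X _ <-] XS] := inf_adherent eta0 S0.
  exists X => _ X'; have : inf S <= fsq (E - Y *m X').
    by apply: ge_inf; [case: S0|exists X'].
  by move: XS; rewrite !fE -WE; lra.
exists (fun Y W => K (Y, W)) => E Y X; rewrite !fE -addrA lerD2l.
by apply: KP; exists E.
Qed.

Definition low_rank_plus n r (E : 'M[R]_n) (s : R) :=
  exists d (V : 'M[R]_(n, d)),
    [/\ V^T *m V = 1%:M, (d <= r)%N & fsq (E - E *m V *m V^T) <= s].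

(** Here [w] bounds a squared norm. Unless [Bs] has a large sketch ([bad1]) or some heavy element
    has a small one ([bad2]), the minimiser [B1] is not heavy. At clipping level [mu = 4 * w / r]
    heaviness puts a factor [r] in the exponent, which pays for the union over the cover; and
    [d * mu <= tau <= 3 * w < r * mu] forces [d <= r]. *)
Lemma prob_selection n m r (A Bs : 'M[R]_n) (F' : seq 'M[R]_n) (w t b : R) :
  0 < w -> 0 < t <= 2^-1 -> (0 < r)%N -> Bs \in F' -> fsq (A - Bs) <= w ->
  expR (- (m%:R * t ^+ 2 / 16)) <= b ->
  (size F')%:R * expR (- (m%:R * t ^+ 2 * r%:R / 32)) <= b ->
  exists bad : pred {ffun 'I_m -> {ffun 'I_n -> bool}},
    prob R bad <= b + b /\
    forall g, ~~ bad g -> forall B1, B1 \in F' ->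
      (forall B, B \in F' -> fsq ((A - B1) *m sgmx R g) <= fsq ((A - B) *m sgmx R g)) ->
      low_rank_plus r (A - B1) ((1 + 4 * t) * w).
Proof.
move=> w0 /andP[t0 t1] r0 BsF ABs b1 b2.
have rp : 0 < r%:R :> R by rewrite ltr0n.
pose mu := 4 * w / r%:R; have mu0 : 0 < mu by rewrite divr_gt0// mulr_gt0.
have t01 : 0 < t <= 1 by apply/andP; split=> //; lra.
pose P (B : 'M[R]_n) (tau : R) := exists d (V : 'M[R]_(n, d)),
  [/\ forall m (t : R), 0 < t <= 1 ->
        prob R (fun z : {ffun 'I_m -> {ffun 'I_n -> bool}} =>
                fsq ((A - B) *m sgmx R z) <= (1 - t) * (m%:R * tau))
        <= expR (- (m%:R * t ^+ 2 * tau / (8 * mu))),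
      V^T *m V = 1%:M, d%:R * mu <= tau & fsq ((A - B) - (A - B) *m V *m V^T) <= tau].
have /choice[tau tauP] : forall B, exists tau, P B tau.
  by move=> B; exact: (clipped_spectrum (A - B) mu0).
pose heavy B := (1 + 4 * t) * w < tau B.
pose up := (1 + t) * (m%:R * w).
pose bad1 := fun g : {ffun 'I_m -> {ffun 'I_n -> bool}} => up <= fsq ((A - Bs) *m sgmx R g).
pose bad2 := fun g : {ffun 'I_m -> {ffun 'I_n -> bool}} =>
  has (fun B => heavy B && (fsq ((A - B) *m sgmx R g) <= up)) F'.
exists (fun g => bad1 g || bad2 g); split.
  apply: (le_trans (prob_or _ _ _)); apply: lerD.
    apply: le_trans b1; have := @prob_qform_upper R n m (gram (A - Bs)) w t w0 t01.
    rewrite trace_gram => H; apply: le_trans (H _ _ _) => //.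
    - by apply: ler_prob => z; rewrite /bad1 fsq_mul_sgmx.
    - exact: symf_gram.
    - exact: psdf_gram.
  apply: le_trans b2; apply: (le_trans (prob_has _ _ _)).
  have -> : (size F')%:R * expR (- (m%:R * t ^+ 2 * r%:R / 32))
    = \sum_(B <- F') expR (- (m%:R * t ^+ 2 * r%:R / 32)).
    by rewrite big_const_seq count_predT iter_addr_0 mulr_natl.
  apply: ler_sum => B _; case: (boolP (heavy B)) => hB; last first.
    by rewrite /prob /expect big1 ?mul0r ?expR_ge0.
  have [d [V [tail _ _ _]]] := tauP B.
  apply: (@le_trans _ _ (expR (- (m%:R * t ^+ 2 * tau B / (8 * mu))))).
    apply: le_trans (tail _ _ t01); apply: ler_prob => z /= h.
    apply: (le_trans h); rewrite /up mulrCA [leRHS]mulrCA ler_wpM2l//.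
    (* For [t <= 1 / 2] one has [1 + t <= (1 - t) * (1 + 4 * t)]: this explains the factor
       [1 + 4 * t]. *)
    apply: (@le_trans _ _ ((1 - t) * ((1 + 4 * t) * w))).
      rewrite mulrA ler_pM2r//; nra.
    by rewrite ler_wpM2l//; [lra|exact: ltW].
  rewrite ler_expR lerN2 ler_pdivrMr//.
  have -> : m%:R * t ^+ 2 * tau B / (8 * mu) * 32 = m%:R * t ^+ 2 * r%:R * (tau B / w).
    by rewrite /mu; field; rewrite !gt_eqF.
  have q0 : 0 <= m%:R * t ^+ 2 * r%:R :> R by rewrite mulr_ge0// mulr_ge0// sqr_ge0.
  rewrite ler_peMr// ler_pdivlMr// mul1r.
  have hB' : (1 + 4 * t) * w < tau B := hB.
  by apply: le_trans (ltW hB'); rewrite ler_peMl//; [exact: ltW|lra].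
move=> g; rewrite negb_or => /andP[nb1 nb2] B1 B1F B1min.
have [d [V [_ VV dmu TV]]] := tauP B1.
have tauB : tau B1 <= (1 + 4 * t) * w.
  rewrite leNgt; apply/negP => hB; move/hasPn: nb2 => /(_ _ B1F).
  rewrite -/(heavy B1) in hB; rewrite hB /= => /negP; apply.
  apply: (le_trans (B1min _ BsF)); move: nb1; rewrite -ltNge; exact: ltW.
exists d, V; split => //; last exact: le_trans TV tauB.
rewrite leqNgt; apply/negP => rd.
have : r%:R * mu < d%:R * mu by rewrite ltr_pM2r// ltr_nat.
have -> : r%:R * mu = 4 * w by rewrite /mu mulrC divfK// gt_eqF.
have : (1 + 4 * t) * w <= 3 * w by rewrite ler_pM2r//; lra.
lra.
Qed.

(** The [T] sketches side by side; [mxvec] flattens the pair (block, column) into one column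
    index. *)
Definition blockmx n T p (z : {ffun 'I_T -> {ffun 'I_p -> {ffun 'I_n -> bool}}}) :
    'M[R]_(n, T * p) :=
  \matrix_(i, c) mxvec (\matrix_(j, l) sgv R (z j l) i) 0 c.

Lemma blockmx_factor n T p (z : {ffun 'I_T -> {ffun 'I_p -> {ffun 'I_n -> bool}}})
    (j : 'I_T) (X : 'M[R]_(p, n)) :
  exists X', blockmx z *m X' = sgmx R (z j) *m X.
Proof.
exists (\matrix_(c, k) mxvec (\matrix_(j', l) if j' == j then X l k else 0) 0 c).
apply/matrixP => i k; rewrite !mxE.
under eq_bigr do rewrite !mxE.
rewrite (reindex _ (curry_mxvec_bij _ _)) /=.
pose F j' l := sgv R (z j' l) i * (if j' == j then X l k else 0).
rewrite (eq_bigr (fun x => F x.1 x.2)) => [|[j' l] _]; last by rewrite /= !mxvecE !mxE.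
rewrite -(pair_bigA _ F) (bigD1 j)//= [X in _ + X]big1 ?addr0 => [|j' /negbTE j'j].
  by apply: eq_bigr => l _; rewrite /F eqxx mxE.
by rewrite big1// => l _; rewrite /F j'j mulr0.
Qed.

(** One good block suffices, as its regression matrix extends by zero to all blocks, and the [T]
    independent blocks fail together with probability at most [2^-1 ^+ T]. The constant is
    [3456 = 3 * 1152], since the tail energy is at most [3 * w]. *)
Lemma prob_range_finder n T p r (E : 'M[R]_n) (w t : R) :
  0 < w -> 0 < t <= 2^-1 -> (0 < r)%N -> (0 < p)%N ->
  low_rank_plus r E ((1 + 4 * t) * w) ->
  (25 * r)%:R ^+ r * expR (- (p%:R / 32)) <= 8^-1 :> R ->
  3456 * r%:R <= t * p%:R ->
  prob R (fun z : {ffun 'I_T -> {ffun 'I_p -> {ffun 'I_n -> bool}}} =>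
    ~~ `[< exists X, fsq (E - E *m blockmx z *m X) <= (1 + 5 * t) * w >]) <= 2^-1 ^+ T.
Proof.
move=> w0 /andP[t0 t1] r0 p0 [d [V [VV dr TV]]] netp pr.
have pp : 0 < p%:R :> R by rewrite ltr0n.
have w3 : 0 < 3 * w by rewrite mulr_gt0.
have TV3 : fsq (E - E *m V *m V^T) <= 3 * w.
  by apply: (le_trans TV); rewrite ler_pM2r//; lra.
have := prob_embedding VV w3 TV3 dr r0 p0 netp.
set bad := (fun z => ~~ _) => Pbad.
apply: (@le_trans _ _ (prob R bad ^+ T)); last first.
  by apply: lerXn2r; rewrite ?nnegrE ?prob_ge0// invr_ge0.
rewrite -prob_forall; apply: ler_prob => z; apply: contraNT.
rewrite negb_forall => /existsP[j]; rewrite negbK => /asboolP[X XE].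
apply/asboolP; have [X' X'E] := blockmx_factor z j X.
exists X'; rewrite -mulmxA X'E mulmxA; apply: (le_trans XE).
have -> : (1 + 5 * t) * w = (1 + 4 * t) * w + t * w by ring.
apply: lerD => //; rewrite ler_pdivrMr//.
have -> : 1152 * (3 * w) * r%:R = w * (3456 * r%:R) by ring.
have -> : t * w * p%:R = w * (t * p%:R) by ring.
by rewrite ler_wpM2l// ltW.
Qed.

Definition select n m (b0 : 'M[R]_n) (F' : seq 'M[R]_n) (G H : 'M[R]_(n, m)) : 'M[R]_n :=
  argmin_seq (fun B => fsq (H - B *m G)) b0 F'.

Definition estimate n k (b0 : 'M[R]_n) (F' : seq 'M[R]_n)
    (K : 'M[R]_(n, k) -> 'M[R]_(n, k) -> 'M[R]_(k, n))
    (B1 : 'M[R]_n) (Y W : 'M[R]_(n, k)) : 'M[R]_n :=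
  argmin_seq (fun B => fsq (B1 + Y *m K Y (W - B1^T *m Y) - B)) b0 F'.

Definition outcome n m k (b0 : 'M[R]_n) (F' : seq 'M[R]_n)
    (K : 'M[R]_(n, k) -> 'M[R]_(n, k) -> 'M[R]_(k, n))
    (A : 'M[R]_n) (G : 'M[R]_(n, m)) (Z : 'M[R]_(n, k)) : 'M[R]_n :=
  let B1 := select b0 F' G (A *m G) in
  let Y := A *m Z - B1 *m Z in
  estimate b0 F' K B1 Y (A^T *m Y).

(** Outside the bad events [Ah] is within [(1 + 3 * t) * w] of [A]. The output is at least as close
    to [Ah] as [Bs], so its distance to [A] is at most [2 * frob (A - Ah) + frob (A - Bs)], which
    gives [3 + 6 * t]. *)
Lemma prob_outcome n m T p r (A b0 Bs : 'M[R]_n) (F' : seq 'M[R]_n) K (w t b : R) :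
  0 < w -> 0 < t <= 2^-1 -> (0 < r)%N -> (0 < p)%N ->
  b0 \in F' -> Bs \in F' -> frob (A - Bs) <= w -> near_lsq K (t * w ^+ 2) ->
  expR (- (m%:R * t ^+ 2 / 16)) <= b ->
  (size F')%:R * expR (- (m%:R * t ^+ 2 * r%:R / 32)) <= b ->
  (25 * r)%:R ^+ r * expR (- (p%:R / 32)) <= 8^-1 :> R ->
  3456 * r%:R <= t * p%:R ->
  prob R (fun x : {ffun 'I_m -> {ffun 'I_n -> bool}} *
                  {ffun 'I_T -> {ffun 'I_p -> {ffun 'I_n -> bool}}} =>
    (3 + 6 * t) * w < frob (A - outcome b0 F' K A (sgmx R x.1) (blockmx x.2)))
  <= b + b + 2^-1 ^+ T.
Proof.
move=> w0 t01 r0 p0 b0F BsF ABs KP h1 h2 h3 h4.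
have w20 : 0 < w ^+ 2 by rewrite exprn_gt0.
have ABs2 : fsq (A - Bs) <= w ^+ 2.
  by rewrite -frob_sqr lerXn2r// nnegrE ?frob_ge0// ltW.
have [bad [Pbad badP]] := prob_selection w20 t01 r0 BsF ABs2 h1 h2.
pose E (g : {ffun 'I_m -> {ffun 'I_n -> bool}}) := A - select b0 F' (sgmx R g) (A *m sgmx R g).
pose Q (g : {ffun 'I_m -> {ffun 'I_n -> bool}}) :=
  fun z : {ffun 'I_T -> {ffun 'I_p -> {ffun 'I_n -> bool}}} =>
    ~~ `[< exists X, fsq (E g - E g *m blockmx z *m X) <= (1 + 5 * t) * w ^+ 2 >].
apply: (@le_trans _ _ (prob R bad + 2^-1 ^+ T)); last by rewrite lerD2r.
have B1P g : E g = A - select b0 F' (sgmx R g) (A *m sgmx R g) /\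
    select b0 F' (sgmx R g) (A *m sgmx R g) \in F' /\
    forall B, B \in F' -> fsq (E g *m sgmx R g) <= fsq ((A - B) *m sgmx R g).
  split=> //; have [? Bmin] := argmin_seqP (fun B => fsq (A *m sgmx R g - B *m sgmx R g)) b0F.
  by split=> // B /Bmin; rewrite /E !mulmxBl.
apply: le_trans (@prob_pair _ _ _ bad Q (2^-1 ^+ T) _ _ _); last first.
- by rewrite card_ffun expn_gt0 card_sign.
- move=> g nbad; apply: (prob_range_finder T w20 t01 r0 p0 _ h3 h4).
  by have [_ [? ?]] := B1P g; apply: badP nbad _ _ _.
- by rewrite exprn_ge0// invr_ge0.
apply: ler_prob => -[g z] /=; apply: contraTT; rewrite negb_or => /andP[_].
rewrite negbK => /asboolP[X XE]; rewrite -leNgt /outcome.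
move: XE; rewrite /E; set B1 := select _ _ _ _ => XE.
set Y := A *m blockmx z - B1 *m blockmx z.
have YE : Y = (A - B1) *m blockmx z by rewrite mulmxBl.
rewrite -YE in XE.
rewrite /estimate; have -> : A^T *m Y - B1^T *m Y = (A - B1)^T *m Y.
  by rewrite [(A - B1)^T]linearB /= mulmxBl.
set Ah := B1 + _; have [_ Bmin] := argmin_seqP (fun B => fsq (Ah - B)) b0F.
set Bt := argmin_seq _ _ _.
(* The regression error [5 * t] and the solver slack [t] add up to
   [1 + 6 * t <= (1 + 3 * t) ^+ 2]. *)
have AAh : frob (A - Ah) <= (1 + 3 * t) * w.
  rewrite -(@ler_pXn2r _ 2)// ?nnegrE ?frob_ge0//; last first.
    by rewrite mulr_ge0// ltW//; lra.
  rewrite frob_sqr exprMn /Ah opprD addrA; apply: (le_trans (KP (A - B1) Y X)).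
  apply: (@le_trans _ _ ((1 + 5 * t) * w ^+ 2 + t * w ^+ 2)); first by rewrite lerD2r.
  rewrite -mulrDl ler_pM2r//; nra.
have ABt : frob (Ah - Bt) <= frob (Ah - Bs) by rewrite !frobE ler_wsqrtr// Bmin.
have -> : A - Bt = (A - Ah) + (Ah - Bt) by rewrite addrA subrK.
apply: (le_trans (ler_frobD _ _)).
have : frob (Ah - Bs) <= frob (A - Ah) + frob (A - Bs).
  have -> : Ah - Bs = (Ah - A) + (A - Bs) by rewrite addrA subrK.
  by rewrite [frob (A - Ah)]frobB; exact: ler_frobD.
lra.
Qed.

End Estimator.

(** * Realising the estimator in the matvec query model *)

Section Transcript.
Variables (R : realType) (Omega : Type) (n : nat).

Lemma size_transcript (alg : matvec_alg R Omega n) w A q :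
  size (mv_transcript alg w A q) = q.
Proof. by elim: q => //= q IH; rewrite size_rcons IH. Qed.

Lemma nth_transcript (alg : matvec_alg R Omega n) w A q i : (i < q)%N ->
  nth 0 (mv_transcript alg w A q) i
  = mv_answer A (mv_query alg w (mv_transcript alg w A i)).
Proof.
elim: q => [//|q IH]; rewrite ltnS leq_eqVlt /= nth_rcons size_transcript.
by case/predU1P => [->|iq]; rewrite ?ltnn ?eqxx// iq IH.
Qed.

Definition answers k (h : seq 'cV[R]_n) (o : nat) : 'M[R]_(n, k) :=
  \matrix_(i, j) nth 0 h (o + j)%N i 0.

Variables (m k : nat).
Variables (G : Omega -> 'M[R]_(n, m)) (Z : Omega -> 'M[R]_(n, k)).
Variables (sel : Omega -> 'M[R]_(n, m) -> 'M[R]_n).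
Variables (fin : 'M[R]_n -> 'M[R]_(n, k) -> 'M[R]_(n, k) -> 'M[R]_n).

Definition residual w (h : seq 'cV[R]_n) : 'M[R]_(n, k) :=
  answers k h m - sel w (answers m h 0) *m Z w.

(** The number of answers received determines the phase: [m] columns of [G], then [k] columns of
    [Z], then [k] transposed queries at the columns of the residual. Later queries are dummies. *)
Definition sketch_query w (h : seq 'cV[R]_n) : bool * 'cV[R]_n :=
  if insub (size h) : option 'I_m is Some j then (false, col j (G w)) else
  if insub (size h - m)%N : option 'I_k is Some j then (false, col j (Z w)) else
  if insub (size h - m - k)%N : option 'I_k is Some j then (true, col j (residual w h))
  else (false, 0).

Definition sketch_alg : matvec_alg R Omega n := MatvecAlg sketch_query
  (fun w h => fin (sel w (answers m h 0)) (residual w h) (answers k h (m + k))).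

Lemma col_answer (M : 'M[R]_n) l (X : 'M[R]_(n, l)) i j :
  (M *m col j X) i 0 = (M *m X) i j.
Proof. by rewrite !mxE; apply: eq_bigr => s _; rewrite !mxE. Qed.

Lemma answers_G w A q : (m <= q)%N ->
  answers m (mv_transcript sketch_alg w A q) 0 = A *m G w.
Proof.
move=> mq; apply/matrixP => i j; rewrite mxE add0n nth_transcript; last first.
  exact: leq_trans (ltn_ord j) mq.
rewrite /= /sketch_query size_transcript insubT//= => jm.
by rewrite /mv_answer /= col_answer; congr (fun_of_matrix _ i _); apply/val_inj.
Qed.

Lemma answers_Z w A q : (m + k <= q)%N ->
  answers k (mv_transcript sketch_alg w A q) m = A *m Z w.
Proof.
move=> mq; apply/matrixP => i j; rewrite mxE nth_transcript; last first.
  by apply: leq_trans mq; rewrite ltn_add2l.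
rewrite /= /sketch_query size_transcript insubF ?ltnNge ?leq_addr//.
rewrite addKn insubT//= => jm.
by rewrite /mv_answer /= col_answer; congr (fun_of_matrix _ i _); apply/val_inj.
Qed.

(** The residual reads only the first [m + k] answers, so every query of the third phase recomputes
    the same [Y], and the last [k] answers are the columns of [A^T *m Y]. *)
Lemma run_sketch_alg w A : mv_run sketch_alg w A (m + k + k) =
  let B1 := sel w (A *m G w) in
  let Y := A *m Z w - B1 *m Z w in
  fin B1 Y (A^T *m Y).
Proof.
have res q : (m + k <= q)%N -> residual w (mv_transcript sketch_alg w A q)
    = A *m Z w - sel w (A *m G w) *m Z w.
  by move=> mq; rewrite /residual answers_Z// answers_G//; apply: leq_trans mq; exact: leq_addr.
rewrite /mv_run [mv_output]lock /= -lock /= res ?leq_addr// answers_G; last first.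
  by rewrite -addnA leq_addr.
congr fin; apply/matrixP => i j; rewrite mxE nth_transcript ?ltn_add2l//.
rewrite /= /sketch_query size_transcript insubF; last first.
  by rewrite ltnNge -addnA leq_addr.
rewrite insubF; last by rewrite -addnA addKn ltnNge leq_addr.
rewrite -addnA addKn addKn insubT//= => jm.
rewrite /mv_answer /= res; last by rewrite addnA leq_addr.
by rewrite col_answer; congr (fun_of_matrix _ i _); apply/val_inj.
Qed.

End Transcript.

(** * A uniform seed as a probability measure on the natural numbers *)

Section UniformSeed.
Variable R : realType.

Definition uniform_nat (N : nat) : set nat -> \bar R :=
  mscale (N.+1%:R^-1)%:nng (msum (fun k => \d_k) N.+1).

HB.instance Definition _ N := Measure.on (uniform_nat N).

Lemma uniform_natE N (S : set nat) :
  uniform_nat N S = ((\sum_(k < N.+1) (\1_S (k : nat))) / N.+1%:R)%:E.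
Proof.
rewrite /uniform_nat /mscale /= /msum mulrC EFinM; congr (_ * _)%E.
by rewrite -sumEFin; apply: eq_bigr.
Qed.

Lemma uniform_nat_setT N : uniform_nat N setT = 1%E.
Proof.
rewrite uniform_natE; congr (_%:E).
under eq_bigr do rewrite indicT.
by rewrite sumr_const card_ord divff// pnatr_eq0.
Qed.

HB.instance Definition _ N := Measure_isProbability.Build _ _ _ (uniform_nat N) (uniform_nat_setT N).

(** The seed indexes the enumeration of [U]. It transfers finite counting bounds to a measure on
    [nat], and neither [P] nor [f] depends on the bad event. *)
Lemma finite_seed (U : finType) : (0 < #|U|)%N ->
  exists (P : probability nat R) (f : nat -> U), forall (b : R) (bad : pred U),
    prob R bad <= b ->
    exists2 S : set nat, measurable S /\ (forall w, S w -> ~~ bad (f w)) & ((1 - b)%:E <= P S)%E.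
Proof.
move=> U0; have u0 : U by move: U0 => /card_gt0P/cid[u _].
(* The predecessor, because [uniform_nat N] charges the [N.+1] points from 0 to [N]. *)
pose N := #|U|.-1; have NE : N.+1 = #|U| by rewrite prednK.
exists (uniform_nat N), (fun w => nth u0 (enum U) w) => b bad Pb.
exists [set w | ~~ bad (nth u0 (enum U) w)]%classic; first by split.
rewrite /= uniform_natE lee_fin; apply: (@le_trans _ _ (1 - prob R bad)).
  by rewrite lerD2l lerN2.
rewrite -prob_compl// /prob /expect NE le_eqVlt; apply/orP; left; apply/eqP.
congr (_ / _); rewrite -(big_mkord xpredT (fun k => \1_[set w | ~~ bad (nth u0 (enum U) w)]%classic k)).
rewrite -big_enum (big_nth u0) -cardE; apply: eq_bigr => k _.
rewrite indicE; case: (boolP (bad _)) => h; congr (_%:R).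
  by rewrite memNset //= h.
by rewrite mem_set.
Qed.

End UniformSeed.

Local Open Scope classical_set_scope.

(** * Choice of the parameters and the query count *)

Section QueryBudget.
Variable R : realType.

(** In the application [s] is the root of the log cardinality, [u = eps^-1], [D = ln (4 / delta)],
    and [36 * u ^+ 2] and [6 * u] come from [t = eps / 6]. The lower bounds on [s], [l1], [l2], [u]
    let one product absorb all lower order terms and roundings. *)
Lemma query_count (s l1 l2 u r D m p T : R) :
  2^-1 <= s -> 1 <= l1 -> 1 <= l2 -> 1 <= u -> 0 <= r <= 3 * s -> 0 <= D <= 4 * l1 ->
  m <= 32 * (r + D) * (36 * u ^+ 2) + 1 ->
  0 <= p -> p <= 32 * (r * (9 * l2) + 3) + 3456 * r * (6 * u) + 1 ->
  T <= 2 * D + 1 ->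
  m + 2 * (T * p) <= 2 * 10 ^+ 6 * (s * l1 * l2) * u ^+ 2.
Proof.
move=> hs h1 h2 hu /andP[r0 rs] /andP[D0 Dl] hm p0 hp hT.
have s0 : 0 <= s by lra.
have l10 : 0 <= l1 by lra.
have l20 : 0 <= l2 by lra.
have u0 : 0 <= u by lra.
have uu : u <= u ^+ 2 by rewrite expr2 ler_peMr.
have uu0 : 0 <= u ^+ 2 by exact: sqr_ge0.
have su : s <= s * l1 * l2.
  by rewrite -mulrA ler_peMr// -[leLHS]mulr1 ler_pM.
pose a := s * l1 * l2 * u ^+ 2.
have e1 : s * u ^+ 2 <= a by rewrite ler_wpM2r.
have e2 : l1 * u ^+ 2 <= 2 * a.
  have h : 1 <= 2 * (s * l2).
    have : s <= s * l2 by rewrite ler_peMr.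
    lra.
  have -> : 2 * a = l1 * u ^+ 2 * (2 * (s * l2)) by rewrite /a; ring.
  by rewrite ler_peMr// mulr_ge0.
have e3 : 1 <= 2 * a.
  apply: le_trans e2; rewrite -[leLHS]mulr1; apply: ler_pM => //.
  by apply: le_trans uu.
have hm' : m <= 1152 * (3 * a + 8 * a) + 2 * a.
  have d1 : r * u ^+ 2 <= 3 * a.
    have := ler_wpM2r uu0 rs; lra.
  have d2 : D * u ^+ 2 <= 8 * a.
    have := ler_wpM2r uu0 Dl; lra.
  have -> : 1152 * (3 * a + 8 * a) + 2 * a = 32 * 36 * (3 * a + 8 * a) + 2 * a by ring.
  move: hm; have -> : 32 * (r + D) * (36 * u ^+ 2) = 32 * 36 * (r * u ^+ 2 + D * u ^+ 2) by ring.
  lra.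
pose c := s * l2 * u.
have c0 : 0 <= c by rewrite !mulr_ge0.
have f1 : s * l2 <= c by rewrite ler_peMr// mulr_ge0.
have f2 : s * u <= c by rewrite /c mulrAC ler_peMr// mulr_ge0.
have f3 : 1 <= 2 * c.
  have : s <= s * l2 by rewrite ler_peMr.
  lra.
have hp' : p <= 10 ^+ 5 * c.
  have d1 : r * l2 <= 3 * c by have := ler_wpM2r l20 rs; lra.
  have d2 : r * u <= 3 * c by have := ler_wpM2r u0 rs; lra.
  move: hp; have -> : 32 * (r * (9 * l2) + 3) + 3456 * r * (6 * u) + 1 =
    288 * (r * l2) + 97 + 20736 * (r * u) by ring.
  lra.
have hT' : T <= 9 * l1 by lra.
have Tp : T * p <= 9 * l1 * (10 ^+ 5 * c).
  apply: (@le_trans _ _ (9 * l1 * p)); first by rewrite ler_wpM2r.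
  by rewrite ler_wpM2l// mulr_ge0.
have ca : l1 * c <= a.
  have -> : l1 * c = s * l1 * l2 * u by rewrite /c; ring.
  by rewrite ler_wpM2l// !mulr_ge0.
move: Tp; have -> : 9 * l1 * (10 ^+ 5 * c) = 9 * 10 ^+ 5 * (l1 * c) by ring.
rewrite -(mulrA (2 * _)) -/a; move: (l1 * c) ca => x; move: (T * p) hm' e3.
clearbody a; clear; move=> y; lra.
Qed.

Lemma ln2_bounds : 2^-1 <= ln (2 : R) <= 1.
Proof.
apply/andP; split.
  have := expR_ge1Dx (- ln (2 : R)); rewrite expRN lnK ?posrE//; lra.
rewrite -ler_expR lnK ?posrE//; have := expR_ge1Dx (1 : R); lra.
Qed.

Lemma succ_truncn_bounds (x : R) : 0 <= x ->
  x <= (Num.truncn x).+1%:R /\ (Num.truncn x).+1%:R <= x + 1.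
Proof.
move=> x0; have /andP[h1 h2] := truncn_itv x0; split; first exact: ltW.
by rewrite -natr1 lerD2r.
Qed.

Lemma lg1_ge1 (x : R) : 1 <= lg1 x.
Proof. by rewrite /lg1 le_max lexx. Qed.

Lemma ln_le_lg1 (x : R) : ln x <= lg1 x.
Proof. by rewrite /lg1 le_max lexx orbT. Qed.

(** With [r] just above [Num.sqrt L], the choice [m * t ^+ 2 >= 32 * (r + D)] gives [m * t ^+ 2 * r
    / 32 >= r ^+ 2 + D * r >= L + D]: this beats the [N = expR L] events while [m] depends on [N]
    only through the root of [L]. *)
Lemma sketch_parameters (N : nat) (eps delta : R) : (1 < N)%N ->
  0 < eps < 1 -> 0 < delta < 1 ->
  let L := ln (N%:R : R) in
  let t := eps / 6 in
  exists m T p r : nat,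
  [/\ (0 < r)%N /\ (0 < p)%N,
      expR (- (m%:R * t ^+ 2 / 16)) <= delta / 4,
      N%:R * expR (- (m%:R * t ^+ 2 * r%:R / 32)) <= delta / 4,
      (25 * r)%:R ^+ r * expR (- (p%:R / 32)) <= 8^-1 :> R /\ 3456 * r%:R <= t * p%:R &
      2^-1 ^+ T <= delta / 2 /\
      (m + T * p + T * p)%:R <=
        2 * 10 ^+ 6 * (Num.sqrt L * lg1 (L / (delta * eps)) * lg1 (L / eps)) / eps ^+ 2].
Proof.
move=> N1 /andP[e0 e1] /andP[d0 d1] L t.
have /andP[ln2l ln2u] := ln2_bounds.
have t0 : 0 < t by rewrite divr_gt0.
have Npos : 0 < N%:R :> R by rewrite ltr0n; apply: leq_trans N1.
have Lh : 2^-1 <= L.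
  by apply: (le_trans ln2l); rewrite ler_ln ?posrE// ler_nat.
have L0 : 0 < L by lra.
pose s := Num.sqrt L.
have s2 : s ^+ 2 = L by rewrite sqr_sqrtr// ltW.
have sp : 0 < s by rewrite sqrtr_gt0.
have sh : 2^-1 <= s.
  by rewrite -(@ler_pXn2r _ 2)// ?nnegrE ?ltW// s2; lra.
pose r := (Num.truncn s).+1.
have [rl ru] := succ_truncn_bounds (ltW sp); rewrite -/r in rl ru.
have r1 : 1 <= r%:R :> R by rewrite ler1n.
pose D := ln (4 / delta).
have d4 : 0 < 4 / delta by rewrite divr_gt0.
have eD : expR (- D) = delta / 4 by rewrite expRN lnK ?posrE// invf_div.
have D0 : 0 <= D.
  rewrite ln_ge0// ler_pdivlMr// mul1r; lra.
pose l1 := lg1 (L / (delta * eps)); pose l2 := lg1 (L / eps).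
have l11 : 1 <= l1 := lg1_ge1 _.
have l21 : 1 <= l2 := lg1_ge1 _.
have lnX (k : nat) : ln (2 ^+ k) = k%:R * ln 2 :> R by rewrite lnXn// mulr_natl.
have Dl : D <= 4 * l1.
  (* Since [L / eps >= 1 / 2]; taking logarithms costs [3 * ln 2 <= 3 * l1]. *)
  have h : 4 / delta <= 2 ^+ 3 * (L / (delta * eps)).
    rewrite ler_pdivrMr//.
    have -> : 2 ^+ 3 * (L / (delta * eps)) * delta = 8 * (L / eps) by field; rewrite !gt_eqF.
    have : L <= L / eps by rewrite ler_pdivlMr// ler_piMr// ltW.
    lra.
  have : D <= ln (2 ^+ 3 * (L / (delta * eps))).
    by rewrite ler_ln ?posrE// mulr_gt0 ?exprn_gt0// divr_gt0// mulr_gt0.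
  rewrite lnM ?posrE ?exprn_gt0 ?divr_gt0 ?mulr_gt0// lnX.
  have := ln_le_lg1 (L / (delta * eps)); rewrite -/l1; lra.
have rp : 0 < r%:R :> R by rewrite ltr0n.
pose lr := ln ((25 * r)%:R : R).
have r25 : 1 <= (25 * r)%:R :> R by rewrite ler1n muln_gt0.
have r25p : 0 < (25 * r)%:R :> R := lt_le_trans ltr01 r25.
have lr0 : 0 <= lr by rewrite ln_ge0.
have lrl : lr <= 9 * l2.
  (* From [r <= s + 1], [s <= 2 * L] and [1 <= 2 * L] one gets [25 * r <= 100 * L]. *)
  have h : (25 * r)%:R <= 2 ^+ 8 * (L / eps).
    have LL : L <= L / eps by rewrite ler_pdivlMr// ler_piMr// ltW.
    have sL : s <= 2 * L.
      have : 2^-1 * s <= s * s by rewrite ler_wpM2r// ltW.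
      rewrite -expr2 s2; lra.
    rewrite natrM; have -> : 2 ^+ 8 = 256 :> R by ring.
    lra.
  have : lr <= ln (2 ^+ 8 * (L / eps)).
    by rewrite ler_ln ?posrE// mulr_gt0 ?exprn_gt0// divr_gt0.
  rewrite lnM ?posrE ?exprn_gt0 ?divr_gt0// lnX.
  have := ln_le_lg1 (L / eps); rewrite -/l2; lra.
pose xm := 32 * (r%:R + D) / t ^+ 2.
have xm0 : 0 <= xm by rewrite divr_ge0 ?sqr_ge0// mulr_ge0// addr_ge0// ltW.
pose m := (Num.truncn xm).+1.
have [ml mu] := succ_truncn_bounds xm0; rewrite -/m in ml mu.
(* As [1 / 2 <= expR (- (1 / 2))], this many blocks bring the failure below
   [expR (- D) = delta / 4]. *)
pose xT := 2 * D; have xT0 : 0 <= xT by rewrite mulr_ge0.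
pose T := (Num.truncn xT).+1.
have [Tl Tu] := succ_truncn_bounds xT0; rewrite -/T in Tl Tu.
(* The first summand pays for the net, leaving [expR (- 3) <= 1 / 8]; the second makes the
   regression error at most a fraction [t]. *)
pose xp := 32 * (r%:R * lr + 3) + 3456 * r%:R / t.
have xp2 : 0 <= 3456 * r%:R / t.
  exact: (divr_ge0 (mulr_ge0 (ler0n R 3456) (ltW rp)) (ltW t0)).
have xp1 : 0 <= 32 * (r%:R * lr + 3).
  by rewrite mulr_ge0// addr_ge0// mulr_ge0// ltW.
have xp0 : 0 <= xp by exact: addr_ge0 xp1 xp2.
pose p := (Num.truncn xp).+1.
have [pl pu] := succ_truncn_bounds xp0; rewrite -/p in pl pu.
have tm : 32 * (r%:R + D) <= m%:R * t ^+ 2.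
  by rewrite -ler_pdivrMr ?exprn_gt0.
exists m, T, p, r; split; first by [].
- rewrite -eD ler_expR lerN2; clear -tm D0 r1; lra.
- rewrite -[X in X * _](@lnK R) ?posrE// -/L -expRD -eD ler_expR.
  have : 32 * (r%:R + D) * r%:R <= m%:R * t ^+ 2 * r%:R by rewrite ler_wpM2r// ltW.
  have : L <= r%:R ^+ 2 by rewrite -s2 lerXn2r// nnegrE ltW.
  have : D <= D * r%:R by rewrite ler_peMr.
  rewrite mulrDr mulrDl -(mulrA 32) -expr2 -(mulrA 32).
  move: (m%:R * t ^+ 2 * r%:R) (r%:R ^+ 2) (D * r%:R); clear => a b c; lra.
- split.
    have -> : (25 * r)%:R = expR lr by rewrite lnK// posrE.
    rewrite -expRM_natl -expRD.
    apply: (@le_trans _ _ (expR (- 3))).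
      rewrite ler_expR; move: pl xp2; rewrite /xp.
      by move: (r%:R * lr) (3456 * r%:R / t); clear => a b; lra.
    have e2 : 2 <= expR (1 : R) by have := expR_ge1Dx (1 : R); clear; lra.
    have -> : - 3 = - (3%:R * 1) :> R by rewrite mulr1.
    rewrite expRN expRM_natl lef_pV2 ?posrE ?exprn_gt0 ?expR_gt0//.
    have -> : 8 = 2 ^+ 3 :> R by ring.
    by rewrite lerXn2r// nnegrE// expR_ge0.
  have : 3456 * r%:R / t <= p%:R.
    by apply: le_trans pl; rewrite /xp lerDr.
  by rewrite ler_pdivrMr// [t * _]mulrC.
- split.
    apply: (@le_trans _ _ (expR (- D))); last by rewrite eD; clear -d0; lra.
    have h : 2^-1 <= expR (- 2^-1) :> R by have := expR_ge1Dx (- 2^-1 : R); clear; lra.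
    apply: (@le_trans _ _ (expR (- 2^-1) ^+ T)).
      by rewrite lerXn2r// ?nnegrE ?invr_ge0 ?expR_ge0.
    rewrite -expRM_natl ler_expR mulrN lerN2; move: Tl; rewrite /xT; clear; lra.
  rewrite -exprVn -addnA addnn -mul2n natrD natrM natrM.
  apply: (@query_count s l1 l2 eps^-1 r%:R D) => //.
  + by rewrite -[leLHS]invr1 lef_pV2 ?posrE// ltW.
  + by clear -sh ru r1; apply/andP; split; lra.
  + by rewrite D0.
  + apply: (le_trans mu); rewrite lerD2r /xm /t le_eqVlt; apply/orP; left; apply/eqP.
    by field; rewrite gt_eqF.
  + apply: (le_trans pu); rewrite lerD2r /xp; apply: lerD.
      rewrite ler_wpM2l// lerD2r ler_wpM2l// ltW.
    rewrite le_eqVlt; apply/orP; left; apply/eqP.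
    by rewrite /t; field; rewrite gt_eqF.
Qed.

End QueryBudget.

(** * Passing from the family to its finite cover *)

Section Cover.
Variable R : realType.

(** The infimum over [F] need not be attained, but the best element of the finite cover is within
    [alpha] of every competitor by the triangle inequality. *)
Lemma cover_best n (F : set 'M[R]_n) (F' : seq 'M[R]_n) (alpha : R) (A : 'M[R]_n) :
  F !=set0 -> is_cover F F' alpha ->
  let i := inf [set frob (A - B) | B in F] in
  0 <= i /\ exists2 Bs, Bs \in F' & frob (A - Bs) <= i + alpha.
Proof.
move=> [X0 FX0] [_ _ cov] /=.
set S := [set _ | _ in _]; have S0 : S !=set0 by exists (frob (A - X0)), X0.
split; first by apply: lb_le_inf => // _ [B _ <-]; exact: frob_ge0.
have [Y0 Y0F _] := cov _ FX0.
have [BsF Bmin] := argmin_seqP (fun B => frob (A - B)) Y0F.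
exists (argmin_seq (fun B => frob (A - B)) Y0 F') => //.
rewrite -lerBlDr; apply: lb_le_inf => // _ [B FB <-].
have [Y YF BY] := cov _ FB.
rewrite lerBlDr (le_trans (Bmin _ YF))//.
have -> : A - Y = (A - B) + (B - Y) by rewrite addrA subrK.
by apply: (le_trans (ler_frobD _ _)); rewrite lerD2l.
Qed.

End Cover.

Theorem theorem3p1 (R : realType) :
  exists2 C : R, 0 < C &
  forall (alpha : R), 0 < alpha ->
  forall (n : nat) (F : set 'M[R]_n) (F' : seq 'M[R]_n),
  F !=set0 -> is_cover F F' alpha ->
  forall eps delta : R, 0 < eps < 1 -> 0 < delta < 1 ->
  let Gamma : R := (size F')%:R in
  exists (d : measure_display) (Omega : measurableType d)
         (P : probability Omega R) (alg : matvec_alg R Omega n) (q : nat),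
  [/\ (q%:R <= C * (Num.sqrt (ln Gamma) * lg1 (ln Gamma / (delta * eps))
                    * lg1 (ln Gamma / eps)) / eps ^+ 2),
      (forall (w : Omega) (A : 'M[R]_n), F (mv_run alg w A q)) &
      forall A : 'M[R]_n,
      exists2 S : set Omega, measurable S /\
        (forall w, S w -> frob (A - mv_run alg w A q)
           <= (3 + eps) * inf [set frob (A - B) | B in F] + (3 + eps) * alpha)
      & ((1 - delta)%:E <= P S)%E].
Proof.
exists (2 * 10 ^+ 6); first by rewrite mulr_gt0// exprn_gt0.
move=> alpha alpha0 n F F' F0 cov eps delta eps01 delta01 Gamma.
have /andP[e0 e1] := eps01; have /andP[d0 d1] := delta01.
have [_ F'F _] := cov.
(* The matrix 0 is arbitrary here: only some member of the cover is wanted, to start the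
   minimisations. *)
have [_ [b0 b0F _]] := cover_best 0 F0 cov.
(* A singleton cover has [ln Gamma = 0], so the budget is zero queries; its only element [b0] is
   returned. *)
have [N1|N1] := leqP (size F') 1.
  have cu : (0 < #|{: unit}|)%N by rewrite card_unit.
  have [P _] := finite_seed R cu.
  exists _, nat, P, (MatvecAlg (fun _ _ => (false, 0)) (fun _ _ => b0)), 0%N; split.
  - by rewrite mulr_ge0 ?invr_ge0 ?sqr_ge0// !mulr_ge0 ?exprn_ge0// ?sqrtr_ge0//;
      apply: le_trans (lg1_ge1 _).
  - by move=> w A; exact: F'F.
  - move=> A; have [i0 [Bs BsF ABs]] := cover_best A F0 cov.
    have Bsb0 : Bs = b0.
      by move: F' N1 b0F BsF {cov F'F Gamma} => [|x [|? ?]]//= _; rewrite !inE => /eqP-> /eqP->.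
    exists setT; last by rewrite probability_setT lee_fin; lra.
    split => // w _; rewrite -mulrDr -Bsb0; apply: (le_trans ABs).
    by rewrite ler_peMl ?addr_ge0// ?(ltW alpha0)//; lra.
have [m [T [p [r [[r0 p0] h1 h2 [h3 h4] [hT hq]]]]]] := sketch_parameters N1 eps01 delta01.
set t := eps / 6 in h1 h2 h4.
have t0 : 0 < t by rewrite divr_gt0.
have t01 : 0 < t <= 2^-1 by rewrite t0 /t; lra.
(* The solver must be fixed before [A] is known, so its slack uses [alpha], a lower bound for the
   unknown scale [i + alpha]. *)
have eta0 : 0 < t * alpha ^+ 2 by rewrite mulr_gt0// exprn_gt0.
have [K KP] := @near_lsq_exists R n (T * p) _ eta0.
pose U : finType := ({ffun 'I_m -> {ffun 'I_n -> bool}} *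
  {ffun 'I_T -> {ffun 'I_p -> {ffun 'I_n -> bool}}})%type.
have U0 : (0 < #|U|)%N.
  by rewrite card_prod muln_gt0 !card_ffun !expn_gt0 card_bool.
have [P [f fP]] := @finite_seed R U U0.
pose alg := @sketch_alg R nat n m (T * p) (fun w => sgmx R (f w).1) (fun w => blockmx R (f w).2)
  (fun w H => select b0 F' (sgmx R (f w).1) H) (estimate b0 F' K).
have runE w A : mv_run alg w A (m + T * p + T * p)
    = outcome b0 F' K A (sgmx R (f w).1) (blockmx R (f w).2).
  exact: run_sketch_alg.
exists _, nat, P, alg, (m + T * p + T * p)%N; split.
- exact: hq.
- move=> w A; rewrite runE; apply: F'F.
  exact: (argmin_seqP _ b0F).1.
- move=> A; have [i0 [Bs BsF ABs]] := cover_best A F0 cov.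
  set i := inf _ in i0 ABs *; have w0 : 0 < i + alpha by rewrite ltr_wpDl.
  have KP' : near_lsq K (t * (i + alpha) ^+ 2).
    move=> E Y X; apply: (le_trans (KP E Y X)); rewrite lerD2l ler_wpM2l ?(ltW t0)//.
    by rewrite lerXn2r ?nnegrE ?lerDr// ltW.
  have := prob_outcome w0 t01 r0 p0 b0F BsF ABs KP' h1 h2 h3 h4.
  set bad := (fun x : _ * _ => _ < _) => Pbad.
  (* The failure budget splits as [delta / 4 + delta / 4 + delta / 2]. *)
  have {}Pbad : prob R bad <= delta by apply: (le_trans Pbad); lra.
  have [S [mS Sgood] PS] := fP delta bad Pbad.
  exists S => //; split=> // w Sw; rewrite runE -mulrDr.
  have := Sgood _ Sw; rewrite /bad -leNgt; have -> : 6 * t = eps by rewrite /t; field.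
  by [].
Qed.
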